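(* Let $\mathbb{k}$ be an algebraically closed field, $Q=(I,E)$ a finite quiver without loops, and $G\subseteq\mathrm{Aut}(\mathbb{k}Q)$ a finite abelian group with $\mathrm{char}\,\mathbb{k}\nmid|G|$ acting admissibly. Let $\widehat Q$ be the generalized McKay quiver of $(Q,G)$, and let $G$ act on $\mathbb{k}\widehat Q$ by the action induced by characters of $G$. Then the generalized McKay quiver $\widehat{\widehat Q}$ of $(\widehat Q,G)$ coincides (up to isomorphism of quivers) with $Q$.
   Context: Action of $G$ on $\mathbb{k}Q$: it permutes the primitive idempotents $\{e_i\mid i\in I\}$ attached to the vertices (hence $G$ acts on $I$) and stabilizes the vector space spanned by the arrows. It is admissible if no arrow connects two vertices in the same $G$-orbit. $\mathcal O_i$ is the $G$-orbit of $i$, $G_i$ its stabilizer, $\mathcal I\subseteq I$ a set of representatives of the $G$-orbits. Generalized McKay quiver of $(Q,G)$ ($G$ abelian): vertices $\widehat I=\{(i,\rho)\mid i\in\mathcal I,\rho\in\mathrm{irr}\,G_i\}$, where $\mathrm{irr}\,G_i$ is a set of representatives of irreducible $\mathbb{k}$-representations of $G_i$. For $i,j\in I$, $G_{ij}=G_i\cap G_j$ and $E_{ij}\subseteq \mathbb{k}Q$ is the span of arrows $i\to j$, a representation of $G_{ij}$; $\mathcal F_{ij}$ is a set of representatives of $G$-orbits on $\mathcal O_i\times\mathcal O_j$ (diagonal action). The arrows $(i,\rho)\to(j,\sigma)$ form a basis of $\bigoplus_{(i',j')\in\mathcal F_{ij}}\mathrm{Hom}_{\mathbb{k}[G_{i'j'}]}(\rho|_{G_{i'j'}},\sigma|_{G_{i'j'}}\otimes_{\mathbb{k}}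 E_{i'j'})$. The same definition applies to any finite quiver with such a $G$-action on its path algebra. Action of $G$ on $\mathbb{k}\widehat Q$: the skew group algebra $\mathbb{k}Q\ast G$ is $\mathbb{k}Q\otimes_{\mathbb{k}}\mathbb{k}[G]$ with product $(\lambda g)(\lambda'g')=\lambda g(\lambda')gg'$. With $e=\sum_{i\in\mathcal I}e_i$ one has (Demonet) $e(\mathbb{k}Q\ast G)e\cong\mathbb{k}\widehat Q$, the vertex $(i,\rho)$ corresponding to $e_ie_\rho$ with $e_\rho\in\mathbb{k}[G_i]$ the primitive idempotent of $\rho$, and the isomorphism respecting the grading by path length. Write $G=\langle g_1\rangle\times\cdots\times\langle g_n\rangle$ with $g_l$ of order $m_l$, let $\xi_l$ be a primitive $m_l$-th root of unity, and for $g=\prod g_l^{t_l}$ put $\chi_g(\prod g_l^{s_l})=\prod\xi_l^{t_ls_l}$. $G$ acts on $\mathbb{k}Q\ast G$ by $g(\lambda h)=\chi_g(h)\lambda h$; this fixes $e$ and so induces an action of $G$ on $\mathbb{k}\widehat Q$, which permutes the vertex idempotents and stabilizes the span of the arrows. *)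

(* Defs.v *)
From HB Require Import structures.
From mathcomp Require Import all_boot all_order all_algebra all_fingroup.
From mathcomp Require Import all_solvable all_field all_character.
From mathcomp Require Import finmap.
From mathcomp.multinomials Require Import monalg.
From mathcomp.real_closed Require Import mxtens.

Set Implicit Arguments.
Unset Strict Implicit.
Unset Printing Implicit Defensive.

Import GRing.Theory.
Local Open Scope ring_scope.

Record quiver := Quiver {
  vert : finType;
  arrow : finType;
  src : arrow -> vert;
  tgt : arrow -> vert
}.

Definition quiver_iso (Q Q' : quiver) : Prop :=
  exists (f : vert Q -> vert Q') (h : arrow Q -> arrow Q'),
    [/\ bijective f, bijective h,
        forall a, src (h a) = f (src a) & forall a, tgt (h a) = f (tgt a)].

Section Paths.
Variable Q : quiver.

Fixpoint walk (i : vert Q) (s : seq (arrow Q)) : bool :=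
  if s is a :: s' then (src a == i) && walk (tgt a) s' else true.

Record qpath := QPath {
  qpath_val : vert Q * seq (arrow Q);
  _ : walk qpath_val.1 qpath_val.2
}.
HB.instance Definition _ := [isSub for qpath_val].
HB.instance Definition _ := [Choice of qpath by <:].

Definition psrc (p : qpath) : vert Q := (val p).1.
Definition pseq (p : qpath) : seq (arrow Q) := (val p).2.
Definition ptgt (p : qpath) : vert Q := last (psrc p) (map (@tgt Q) (pseq p)).
Definition plen (p : qpath) : nat := size (pseq p).

Definition pvert (i : vert Q) : qpath := @QPath (i, [::]) isT.

Fact walk1 (a : arrow Q) : walk (src a) [:: a].
Proof. by rewrite /= eqxx. Qed.
Definition parrow (a : arrow Q) : qpath := @QPath (src a, [:: a]) (walk1 a).

(* Concatenation reads from left to right: p first, then q; it is defined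
   exactly when the target of p is the source of q (see pcatP). *)
Definition pcat (p q : qpath) : option qpath :=
  if ptgt p == psrc q then insub (psrc p, pseq p ++ pseq q) else None.

Lemma walk_cat i s t :
  walk i (s ++ t) = walk i s && walk (last i (map (@tgt Q) s)) t.
Proof. by elim: s i => //= a s IH i; rewrite IH andbA. Qed.

Variant pcat_spec (p q : qpath) : option qpath -> Prop :=
| PcatSome r of ptgt p = psrc q & psrc r = psrc p & ptgt r = ptgt q
    & pseq r = pseq p ++ pseq q : pcat_spec p q (Some r)
| PcatNone of ptgt p != psrc q : pcat_spec p q None.

Lemma pcatP p q : pcat_spec p q (pcat p q).
Proof.
rewrite /pcat; case: eqP => [e|/eqP]; last exact: PcatNone.
have w : walk (psrc p) (pseq p ++ pseq q).
  by rewrite walk_cat (valP p) -/(ptgt p) e (valP q).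
rewrite insubT; constructor=> //.
by rewrite /ptgt /psrc /pseq /= map_cat last_cat -/(ptgt p) e.
Qed.

Lemma qpathP (p q : qpath) : psrc p = psrc q -> pseq p = pseq q -> p = q.
Proof.
by move=> e1 e2; apply/val_inj; rewrite [val p]surjective_pairing
  [val q]surjective_pairing; congr (_, _).
Qed.

Lemma pcatA p q r : obind (pcat p) (pcat q r) = obind (pcat^~ r) (pcat p q).
Proof.
case: (pcatP q r) => [qr e1 s1 t1 q1|n1] /=;
  case: (pcatP p q) => [pq e2 s2 t2 q2|n2] //=.
- case: (pcatP p qr) => [x ex sx tx qx|/eqP]; last by rewrite s1 e2.
  case: (pcatP pq r) => [y ey sy ty qy|/eqP]; last by rewrite t2 e1.
  by congr Some; apply: qpathP; rewrite ?sx ?sy // qx qy q1 q2 catA.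
- by case: (pcatP p qr) => // x ex; move: n2; rewrite ex s1 eqxx.
- by case: (pcatP pq r) => // y ey; move: n1; rewrite -ey t2 eqxx.
Qed.

Lemma pcat_vertl i p : pcat (pvert i) p = if i == psrc p then Some p else None.
Proof.
case: (pcatP (pvert i) p) => [r /= e1 e2 _ e4|/= /negbTE]; last by move=> ->.
rewrite -e1 eqxx; congr Some; apply: qpathP => //.
by rewrite e2 -e1.
Qed.

Lemma pcat_vertr i p : pcat p (pvert i) = if i == ptgt p then Some p else None.
Proof.
case: (pcatP p (pvert i)) => [r e1 e2 _ e4|/negbTE].
  by rewrite e1 eqxx; congr Some; apply: qpathP; rewrite // e4 cats0.
by rewrite eq_sym => ->.
Qed.

End Paths.

Definition path_alg (k : fieldType) (Q : quiver) : Type := {malg k[qpath Q]}.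
HB.instance Definition _ (k : fieldType) (Q : quiver) :=
  GRing.Lmodule.copy (path_alg k Q) {malg k[qpath Q]}.

HB.lock Definition pelt (k : fieldType) (Q : quiver) (p : qpath Q) : path_alg k Q :=
  << p >>.
Definition coef (k : fieldType) (Q : quiver) (p : qpath Q) (x : path_alg k Q) : k :=
  x@_p.
Arguments pelt k {Q} p.

HB.lock Definition pamul (k : fieldType) (Q : quiver) (x y : path_alg k Q) :
    path_alg k Q :=
  \sum_(p <- msupp x) \sum_(q <- msupp y)
    (coef p x * coef q y) *: oapp (pelt k) 0 (pcat p q).

Section PathAlgebra.
Variables (k : fieldType) (Q : quiver).
Local Notation A := (path_alg k Q).
Local Notation pelt := (@pelt k Q).
Local Notation pamul := (@pamul k Q).
Local Notation oelt := (oapp pelt (0 : A)).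

Definition paone : A := \sum_(i : vert Q) pelt (pvert i).

Lemma coefD p x y : coef p (x + y : A) = coef p x + coef p y.
Proof. exact: mcoeffD. Qed.

Lemma coefZ p c x : coef p (c *: x : A) = c * coef p x.
Proof. exact: mcoeffZ. Qed.

Lemma coef_pelt q p : coef q (pelt p) = (p == q)%:R.
Proof. by rewrite pelt.unlock; exact: mcoeffU. Qed.

Lemma path_algP (x y : A) : (forall p, coef p x = coef p y) -> x = y.
Proof. by move=> e; apply/malgP. Qed.

Lemma pamulw (D1 D2 : {fset qpath Q}) (x y : A) :
  (msupp x `<=` D1)%fset -> (msupp y `<=` D2)%fset ->
  pamul x y =
  \sum_(p <- D1) \sum_(q <- D2) (coef p x * coef q y) *: oelt (pcat p q).
Proof.
move=> s1 s2; rewrite pamul.unlock (big_fset_incl _ s1) /=; last first.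
  move=> p _ /mcoeff_outdom p0; rewrite big1 // => q _.
  by rewrite /coef p0 mul0r scale0r.
apply: eq_bigr => p _; apply: (big_fset_incl _ s2) => q _ /mcoeff_outdom q0.
by rewrite /coef q0 mulr0 scale0r.
Qed.

Fact pamulDl : left_distributive pamul +%R.
Proof.
move=> x y z; set D := (msupp x `|` msupp y)%fset.
rewrite (@pamulw D (msupp z) (x + y)) ?msuppD_le //.
rewrite (@pamulw D (msupp z) x) ?fsubsetUl // (@pamulw D (msupp z) y) ?fsubsetUr //.
rewrite -big_split; apply: eq_bigr => p _; rewrite -big_split.
by apply: eq_bigr => q _; rewrite coefD mulrDl scalerDl.
Qed.

Fact pamulDr : right_distributive pamul +%R.
Proof.
move=> z x y; set D := (msupp x `|` msupp y)%fset.
rewrite (@pamulw (msupp z) D z (x + y)) ?msuppD_le //.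
rewrite (@pamulw (msupp z) D z x) ?fsubsetUl // (@pamulw (msupp z) D z y) ?fsubsetUr //.
rewrite -big_split; apply: eq_bigr => p _; rewrite -big_split.
by apply: eq_bigr => q _; rewrite coefD mulrDr scalerDl.
Qed.

Fact pamulZl c x y : c *: pamul x y = pamul (c *: x) y.
Proof.
rewrite (@pamulw (msupp x) (msupp y) (c *: x)) ?msuppZ_le // pamul.unlock.
rewrite scaler_sumr; apply: eq_bigr => p _; rewrite scaler_sumr.
by apply: eq_bigr => q _; rewrite coefZ scalerA mulrA.
Qed.

Fact pamulZr c x y : c *: pamul x y = pamul x (c *: y).
Proof.
rewrite (@pamulw (msupp x) (msupp y) x (c *: y)) ?msuppZ_le // pamul.unlock.
rewrite scaler_sumr; apply: eq_bigr => p _; rewrite scaler_sumr.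
by apply: eq_bigr => q _; rewrite coefZ scalerA mulrCA.
Qed.

Fact pamul0l y : pamul 0 y = 0.
Proof. by rewrite pamul.unlock msupp0 big_seq_fset0. Qed.

Fact pamul0r x : pamul x 0 = 0.
Proof. by rewrite pamul.unlock big1 // => p _; rewrite msupp0 big_seq_fset0. Qed.

Lemma pamul_elt p q : pamul (pelt p) (pelt q) = oelt (pcat p q).
Proof.
rewrite (@pamulw [fset p]%fset [fset q]%fset) ?[in msupp _]pelt.unlock ?msuppU_le //.
by rewrite !big_seq_fset1 !coef_pelt !eqxx mulr1 scale1r.
Qed.

Lemma path_algE (x : A) : x = \sum_(p <- msupp x) coef p x *: pelt p.
Proof.
rewrite {1}[x]monalgE; apply: eq_bigr => p _; apply: path_algP => q.
rewrite [RHS]coefZ [in RHS]coef_pelt mulr_natr.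
exact: mcoeffU.
Qed.

Lemma pamul_suml I (r : seq I) (F : I -> A) y :
  pamul (\sum_(i <- r) F i) y = \sum_(i <- r) pamul (F i) y.
Proof. by apply: (big_morph (pamul^~ y)) => [u v|]; rewrite ?pamulDl ?pamul0l. Qed.

Lemma pamul_sumr I (r : seq I) (F : I -> A) x :
  pamul x (\sum_(i <- r) F i) = \sum_(i <- r) pamul x (F i).
Proof. by apply: (big_morph (pamul x)) => [u v|]; rewrite ?pamulDr ?pamul0r. Qed.

Lemma path_alg_ext (f g : A -> A) :
  (forall u v, f (u + v) = f u + f v) -> (forall c u, f (c *: u) = c *: f u) ->
  (forall u v, g (u + v) = g u + g v) -> (forall c u, g (c *: u) = c *: g u) ->
  (forall p, f (pelt p) = g (pelt p)) -> f =1 g.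
Proof.
move=> fD fZ gD gZ e u.
have f0 : f 0 = 0 by apply: (addrI (f 0)); rewrite -fD !addr0.
have g0 : g 0 = 0 by apply: (addrI (g 0)); rewrite -gD !addr0.
rewrite [u]path_algE (big_morph f fD f0) (big_morph g gD g0).
by apply: eq_bigr => p _; rewrite fZ gZ e.
Qed.

Lemma path_alg_assoc (m : A -> A -> A) :
  left_distributive m +%R -> right_distributive m +%R ->
  (forall c x y, c *: m x y = m (c *: x) y) ->
  (forall c x y, c *: m x y = m x (c *: y)) ->
  (forall p q r, m (pelt p) (m (pelt q) (pelt r)) = m (m (pelt p) (pelt q)) (pelt r)) ->
  associative m.
Proof.
move=> mDl mDr mZl mZr mA x y z.
apply: (path_alg_ext (f := fun x => m x (m y z)) (g := fun x => m (m x y) z)) x.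
- by move=> u v /=; rewrite mDl.
- by move=> c u /=; rewrite -mZl.
- by move=> u v /=; rewrite !mDl.
- by move=> c u /=; rewrite -!mZl.
move=> p; apply: (path_alg_ext (f := fun y => m (pelt p) (m y z))
    (g := fun y => m (m (pelt p) y) z)) y.
- by move=> u v /=; rewrite mDl mDr.
- by move=> c u /=; rewrite -mZl -mZr.
- by move=> u v /=; rewrite mDr mDl.
- by move=> c u /=; rewrite -mZr -mZl.
move=> q; apply: (path_alg_ext (f := fun z => m (pelt p) (m (pelt q) z))
    (g := fun z => m (m (pelt p) (pelt q)) z)) z.
- by move=> u v /=; rewrite !mDr.
- by move=> c u /=; rewrite -!mZr.
- by move=> u v /=; rewrite mDr.
- by move=> c u /=; rewrite -mZr.
by move=> r; apply: mA.
Qed.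

Fact pamulA : associative pamul.
Proof.
apply: path_alg_assoc.
- exact: pamulDl.
- exact: pamulDr.
- exact: pamulZl.
- exact: pamulZr.
move=> p q r; rewrite !pamul_elt.
have := pcatA p q r.
case: (pcat q r) (pcat p q) => [qr|] [pq|] /=;
  rewrite ?pamul0l ?pamul0r ?pamul_elt //=.
- by move=> ->.
- by move=> ->.
- by move=> <-.
Qed.

Fact pamul1l : left_id paone pamul.
Proof.
move=> x; rewrite [x]path_algE pamul_sumr; apply: eq_bigr => p _.
rewrite -pamulZr; congr (_ *: _); rewrite pamul_suml (bigD1 (psrc p)) //=.
rewrite pamul_elt pcat_vertl eqxx big1 ?addr0 // => i /negbTE ip.
by rewrite pamul_elt pcat_vertl ip.
Qed.

Fact pamul1r : right_id paone pamul.
Proof.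
move=> x; rewrite [x]path_algE pamul_suml; apply: eq_bigr => p _.
rewrite -pamulZl; congr (_ *: _); rewrite pamul_sumr (bigD1 (ptgt p)) //=.
rewrite pamul_elt pcat_vertr eqxx big1 ?addr0 // => i /negbTE ip.
by rewrite pamul_elt pcat_vertr ip.
Qed.

(* Only a possibly trivial ring: the path algebra of the empty quiver is 0. *)
HB.instance Definition _ := GRing.Zmodule_isPzRing.Build A
  pamulA pamul1l pamul1r pamulDl pamulDr.

Definition evert (i : vert Q) : A := pelt (pvert i).
Definition earrow (a : arrow Q) : A := pelt (parrow a).

Definition homogeneous (n : nat) (x : A) : Prop :=
  forall p, p \in msupp x -> plen p = n.

End PathAlgebra.

Arguments evert k {Q} i.
Arguments earrow k {Q} a.

Record quiver_action (k : fieldType) (gT : finGroupType) (Q : quiver) :=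
  QuiverAction {
    qact :> gT -> path_alg k Q -> path_alg k Q;
    qact_linear : forall g, linear (qact g);
    qact_monoid : forall g, monoid_morphism (qact g);
    qact1 : forall x, qact 1%g x = x;
    qactM : forall g h x, qact (g * h)%g x = qact g (qact h x);
    vact : gT -> vert Q -> vert Q;
    qact_vert : forall g i, qact g (evert k i) = evert k (vact g i);
    qact_arrow : forall g x, homogeneous 1 x -> homogeneous 1 (qact g x)
  }.

Section Action.
Variables (k : fieldType) (gT : finGroupType) (Q : quiver).
Variable act : quiver_action k gT Q.

Lemma evert_inj : injective (@evert k Q).
Proof.
move=> i j /(congr1 (coef (pvert j))); rewrite /evert !coef_pelt eqxx.
by case: eqP => [/(congr1 (@psrc Q))|_ /eqP] //; rewrite eq_sym oner_eq0.
Qed.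

Lemma vact1 i : vact act 1%g i = i.
Proof. by apply: evert_inj; rewrite -qact_vert qact1. Qed.

Lemma vactM g h i : vact act (g * h)%g i = vact act g (vact act h i).
Proof. by apply: evert_inj; rewrite -!qact_vert qactM. Qed.

Definition vorbit (i : vert Q) : {set vert Q} := [set vact act g i | g : gT].

Definition vstab (i : vert Q) : {set gT} := [set g | vact act g i == i].
Fact vstab_group_set i : group_set (vstab i).
Proof.
apply/group_setP; split=> [|g h]; rewrite !inE ?vact1 // => /eqP gi /eqP hi.
by rewrite vactM hi gi.
Qed.
Canonical vstab_group i := Group (vstab_group_set i).

Definition vorbit2 (p : vert Q * vert Q) : {set vert Q * vert Q} :=
  [set (vact act g p.1, vact act g p.2) | g : gT].

Definition admissible : Prop :=
  forall a : arrow Q, tgt a \notin vorbit (src a).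

Definition arrows_btw (Q' : quiver) (i j : vert Q') : finType :=
  {a : arrow Q' | (src a == i) && (tgt a == j)}.

(* The matrix of g on E_ij in its basis of arrows i -> j; it gives the
   representation of G_ij on E_ij when g fixes both i and j. Matrices act on
   column vectors. *)
Definition arrow_mx (i j : vert Q) (g : gT) : 'M[k]_#|arrows_btw i j| :=
  \matrix_(r, c) coef (parrow (val (enum_val r)))
                      (act g (earrow k (val (enum_val c)))).

End Action.

Record irr_reps (k : fieldType) (gT : finGroupType) (G : {group gT}) := IrrReps {
  irr_idx :> finType;
  irr_deg : irr_idx -> nat;
  irr_rep : forall r, mx_representation k G (irr_deg r);
  irr_irreducible : forall r, mx_irreducible (irr_rep r);
  irr_distinct : forall r s, mx_rsim (irr_rep r) (irr_rep s) -> r = s;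
  irr_complete : forall d (rG : mx_representation k G d),
    mx_irreducible rG -> exists r, mx_rsim (irr_rep r) rG
}.

Record mckay_choice (k : fieldType) (gT : finGroupType) (Q : quiver)
    (act : quiver_action k gT Q) := MckayChoice {
  mc_verts : {set vert Q};
  mc_vertsP :
    is_transversal mc_verts [set vorbit act i | i : vert Q] [set: vert Q];
  mc_irr : forall i : vert Q, irr_reps k (vstab_group act i);
  mc_pairs : vert Q -> vert Q -> {set vert Q * vert Q};
  mc_pairsP : forall i j,
    is_transversal (mc_pairs i j)
      [set vorbit2 act p | p in setX (vorbit act i) (vorbit act j)]
      (setX (vorbit act i) (vorbit act j))
}.

Section McKay.
Variables (k : fieldType) (gT : finGroupType) (Q : quiver).
Variables (act : quiver_action k gT Q) (c : mckay_choice act).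

Definition mckay_vert : finType :=
  {x : {i : vert Q & irr_idx (mc_irr c i)} | tag x \in mc_verts c}.

Definition mv_vert (x : mckay_vert) : vert Q := tag (val x).
Definition mv_irr (x : mckay_vert) : mc_irr c (mv_vert x) := tagged (val x).
Definition mv_deg (x : mckay_vert) : nat := irr_deg (mv_irr x).
Definition mv_rep (x : mckay_vert) :
  mx_representation k (vstab_group act (mv_vert x)) (mv_deg x) :=
  irr_rep (mv_irr x).

(* Matrices of linear maps rho -> sigma (x) E_p, for x = (i, rho),
   y = (j, sigma) and p in O_i x O_j. *)
Definition hom_mx (x y : mckay_vert) (p : vert Q * vert Q) : Type :=
  'M[k]_(mv_deg y * #|arrows_btw p.1 p.2|, mv_deg x).
HB.instance Definition _ x y p := GRing.Lmodule.on (hom_mx x y p).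

(* G_i = G_{i'} for i' in O_i since the group is abelian, so that the
   representations of G_i and G_j do restrict to G_p. *)
Definition is_hom (x y : mckay_vert) (p : vert Q * vert Q) (X : hom_mx x y p) :=
  forall g, g \in vstab act p.1 :&: vstab act p.2 ->
    (mv_rep y g *t arrow_mx act p.1 p.2 g) *m X = X *m mv_rep x g.

(* An element of the direct sum of the Hom spaces is a family indexed by all
   pairs p, of which only the entries at p in F_ij matter. *)
Definition is_hom_basis (x y : mckay_vert) (B : finType)
    (b : B -> forall p, hom_mx x y p) : Prop :=
  let F := mc_pairs c (mv_vert x) (mv_vert y) in
  (forall a p, p \in F -> is_hom (b a p)) /\
  (forall v : (forall p, hom_mx x y p), (forall p, p \in F -> is_hom (v p)) ->
     exists! l : {ffun B -> k},
       forall p, p \in F -> v p = \sum_(a : B) l a *: b a p).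

End McKay.

Record mckay (k : fieldType) (gT : finGroupType) (Q : quiver)
    (act : quiver_action k gT Q) := Mckay {
  mk_choice : mckay_choice act;
  mk_arrow : finType;
  mk_src : mk_arrow -> mckay_vert mk_choice;
  mk_tgt : mk_arrow -> mckay_vert mk_choice;
  mk_basis : forall x y,
    exists b : arrows_btw (Q' := Quiver mk_src mk_tgt) x y ->
               forall p, hom_mx x y p,
      is_hom_basis b
}.

Definition mckay_quiver k gT Q (act : quiver_action k gT Q) (H : mckay act) :=
  Quiver (@mk_src _ _ _ _ H) (@mk_tgt _ _ _ _ H).
Coercion mckay_quiver : mckay >-> quiver.

Definition skew_alg (k : fieldType) (gT : finGroupType) (Q : quiver)
  (act : quiver_action k gT Q) : Type := {ffun gT -> path_alg k Q}.
HB.instance Definition _ k gT Q (act : quiver_action k gT Q) :=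
  GRing.Lmodule.copy (skew_alg act) {ffun gT -> path_alg k Q}.

Section SkewAlgebra.
Variables (k : fieldType) (gT : finGroupType) (Q : quiver).
Variable act : quiver_action k gT Q.
Local Notation S := (skew_alg act).

Definition sk_fun (z : S) : gT -> path_alg k Q := fun_of_fin z.
Definition sk_mk (f : gT -> path_alg k Q) : S := finfun f.

(* z : S stands for the sum over g of z(g) (x) g. *)
Definition smul (z w : S) : S :=
  sk_mk (fun g => \sum_(h : gT) sk_fun z h * act h (sk_fun w (h^-1 * g)%g)).
Definition stens (x : path_alg k Q) (g : gT) : S :=
  sk_mk (fun h => if h == g then x else 0).
Definition sone : S := stens 1 1%g.

Lemma skewP (z w : S) : (forall g, sk_fun z g = sk_fun w g) -> z = w.
Proof. by move=> e; apply/ffunP. Qed.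

Lemma skE f g : sk_fun (sk_mk f) g = f g.
Proof. exact: ffunE. Qed.

Lemma skD z w g : sk_fun (z + w) g = sk_fun z g + sk_fun w g.
Proof. exact: ffunE. Qed.

Lemma qactD g x y : act g (x + y) = act g x + act g y.
Proof. by rewrite -[x]scale1r qact_linear !scale1r. Qed.

Lemma qact0 g : act g 0 = 0.
Proof. by apply: (addrI (act g 0)); rewrite -qactD !addr0. Qed.

Lemma qact_mul g x y : act g (x * y) = act g x * act g y.
Proof. by case: (qact_monoid act g) => _ ->. Qed.

Lemma qact_one g : act g 1 = 1.
Proof. by case: (qact_monoid act g). Qed.

Fact smulDl : left_distributive smul +%R.
Proof.
move=> x y z; apply: skewP => g; rewrite skD !skE -big_split.
by apply: eq_bigr => h _; rewrite skD mulrDl.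
Qed.

Fact smulDr : right_distributive smul +%R.
Proof.
move=> z x y; apply: skewP => g; rewrite skD !skE -big_split.
by apply: eq_bigr => h _; rewrite skD qactD mulrDr.
Qed.

Fact smul1l : left_id sone smul.
Proof.
move=> z; apply: skewP => g; rewrite skE (bigD1 1%g) //= big1 => [|h /negbTE h1].
  by rewrite skE eqxx mul1r qact1 invg1 mul1g addr0.
by rewrite skE h1 mul0r.
Qed.

Fact smul1r : right_id sone smul.
Proof.
move=> z; apply: skewP => g; rewrite skE (bigD1 g) //= big1 => [|h /negbTE h1].
  by rewrite skE mulVg eqxx qact_one mulr1 addr0.
rewrite skE -eq_mulVg1 h1 qact0 mulr0 //.
Qed.

Fact smulA : associative smul.
Proof.
move=> x y z; apply: skewP => g; rewrite !skE.
under [RHS]eq_bigr => h _ do rewrite skE mulr_suml.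
rewrite [RHS]exchange_big /=; apply: eq_bigr => h _; rewrite skE.
rewrite (big_morph (act h) (@qactD h) (@qact0 h)) mulr_sumr.
rewrite [RHS](reindex_inj (mulgI h)) /=; apply: eq_bigr => u _.
by rewrite qact_mul -qactM mulrA mulKg invMg mulgA.
Qed.

HB.instance Definition _ := GRing.Zmodule_isPzRing.Build S
  smulA smul1l smul1r smulDl smulDr.

(* The idempotent of k[H] attached to an irreducible representation rho, with
   k[H] e_rho isotypic of type rho; it is primitive when H is abelian. *)
Definition rep_idem (H : {group gT}) (d : nat) (rho : mx_representation k H d) :
  S :=
  (d%:R / #|H|%:R) *: \sum_(h in H) \tr (rho h^-1%g) *: stens 1 h.

(* The action of g by the character chi_g. *)
Definition char_twist (chi : gT -> gT -> k) (g : gT) (z : S) : S :=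
  sk_mk (fun h => chi g h *: sk_fun z h).

End SkewAlgebra.

Section Corner.
Variables (k : fieldType) (gT : finGroupType) (Q : quiver).
Variables (act : quiver_action k gT Q) (H : mckay act).

Definition corner_idem : skew_alg act :=
  \sum_(i in mc_verts (mk_choice H)) stens act (evert k i) 1%g.

(* With e_i kQ e_j the span of the paths from i to j, the arrows x -> y of the
   McKay quiver correspond to e_x (kQ * G)_1 e_y, where e_(i, rho) = e_i e_rho. *)
Record corner_iso := CornerIso {
  ci_fun :> path_alg k H -> skew_alg act;
  ci_linear : linear ci_fun;
  ci_inj : injective ci_fun;
  ci_range : forall z,
    (exists x, ci_fun x = z) <-> corner_idem * z * corner_idem = z;
  ci_one : ci_fun 1 = corner_idem;
  ci_mul : forall x y, ci_fun (x * y) = ci_fun x * ci_fun y;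
  ci_vert : forall x : mckay_vert (mk_choice H),
    ci_fun (@evert k H x) =
    stens act (evert k (mv_vert x)) 1%g * rep_idem act (mv_rep x);
  ci_graded : forall n x, homogeneous n x ->
    forall g, homogeneous n (sk_fun (ci_fun x) g)
}.

End Corner.

(* Main.v *)
(* Write eps x for the image in S = kQ * G of the vertex idempotent of x = (i, rho),
   chi for the pairing G x G -> k, and G_i^perp for the orthogonal of G_i. The
   twist by g maps eps x to eps (g x); Fourier inversion turns the sum of its
   orbit into a nonzero multiple of e_i, so the orbits of G on the vertices of
   the McKay quiver are the sets {i} x irr G_i, with stabilizers G_i^perp. As
   every character of G_i^perp is chi _ t for a t unique modulo G_i, the pair
   (x, tau) |-> t^-1 i matches the vertices of the double McKay quiver with I.
   For the arrows between (x, tau) and (y, upsilon), put h = t_tau t_upsilon^-1.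
   A morphism tau -> upsilon (x) E_p is an element z_p of e_p.1 (kQh)_1 e_p.2 on
   which each g fixing p acts by chi g h. Adding up the h-components of the z_p
   over the orbit representatives p gives an isomorphism onto E_(i, hj): a z_p is
   recovered by compressing the sum with eps p.1 and eps p.2, because
   |G| z(h) (x) h is the sum over g of chi g h^-1 times the twist of z by g. *)
Require Import Defs.
From mathcomp Require Import all_boot all_order all_algebra all_fingroup.
From mathcomp Require Import all_solvable all_field all_character.
From mathcomp Require Import finmap ring.
From mathcomp.multinomials Require Import monalg.
From mathcomp.real_closed Require Import mxtens.

Set Implicit Arguments.
Unset Strict Implicit.
Unset Printing Implicit Defensive.

Import GRing.Theory.
Local Open Scope ring_scope.

(** * Path algebras *)

(** A vector killed by the matrix of coefficients of [u] in terms of [v] is a linear relation among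
    the [u a], hence zero. The matrix then has full row rank, and the rank is at most the number of
    columns. [W] may have infinite dimension, as path algebras do. *)
Lemma leq_card_free (k : fieldType) (W : lmodType k) (A B : finType)
    (u : A -> W) (v : B -> W) :
  (forall l : A -> k, \sum_a l a *: u a = 0 -> forall a, l a = 0) ->
  (forall a, exists c : B -> k, u a = \sum_b c b *: v b) ->
  (#|A| <= #|B|)%N.
Proof.
move=> freeu /fin_all_exists[c uE].
pose M : 'M[k]_(#|A|, #|B|) := \matrix_(i, j) c (enum_val i) (enum_val j).
suff /eqP <- : row_free M by exact: rank_leq_col.
rewrite -kermx_eq0; apply/eqP/row_matrixP => r; rewrite row0.
set x := row r _; have xM : x *m M = 0 by apply/sub_kermxP; exact: row_sub.
apply/rowP=> j; rewrite [RHS]mxE -[j]enum_valK.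
apply: (freeu (fun a => x 0 (enum_rank a))).
under eq_bigr => a _ do rewrite uE scaler_sumr.
rewrite exchange_big big1 //= => b _.
under eq_bigr => a _ do rewrite scalerA.
rewrite -scaler_suml [X in X *: _](_ : _ = (x *m M) 0 (enum_rank b)).
  by rewrite xM mxE scale0r.
rewrite mxE (reindex (@enum_val A xpredT)) /=; last first.
  exact: onW_bij (enum_val_bij _).
by apply: eq_bigr => i _; rewrite enum_valK [M _ _]mxE enum_rankK.
Qed.

(** Equal fibre sizes make the lists of values of [p] and [q] permutations of each other; such a
    permutation, read on the enumerations of [A] and [B], is the bijection. *)
Lemma bij_of_card_fibers (T A B : finType) (p : A -> T) (q : B -> T) :
  (forall t, #|[pred a | p a == t]| = #|[pred b | q b == t]|) ->
  exists2 h : A -> B, bijective h & forall a, q (h a) = p a.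
Proof.
move=> e; have pq : perm_eq (map p (enum A)) (map q (enum B)).
  apply/allP=> t _ /=; rewrite !count_map; apply/eqP.
  have := e t; rewrite !cardE !size_filter /=.
  by rewrite /enum_mem; congr (_ = _); rewrite count_filter;
    apply: eq_count => x /=; rewrite andbT.
have AB : #|A| = #|B|.
  by have := perm_size pq; rewrite !size_map -!enumT -!cardE.
pose s := map_tuple p (enum_tuple A).
pose t := tcast (esym AB) (map_tuple q (enum_tuple B)).
have /tuple_permP[w sE] : perm_eq s t by rewrite val_tcast.
pose h a := enum_val (cast_ord AB (w (enum_rank a))).
exists h.
  exists (fun b => enum_val ((w^-1)%g (cast_ord (esym AB) (enum_rank b)))) => x.
    by rewrite /h enum_valK cast_ordK permK enum_rankK.
  by rewrite /h enum_valK permKV cast_ordKV enum_rankK.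
move=> a; have : tnth s (enum_rank a) = tnth t (w (enum_rank a)).
  have /val_inj -> : val s = val [tuple tnth t (w i) | i < #|A|] by [].
  by rewrite tnth_mktuple.
have enumE (C : finType) (i : 'I_#|C|) : tnth (enum_tuple C) i = enum_val i.
  exact: tnth_nth.
by rewrite /t tcastE !tnth_map !enumE enum_rankK esymK.
Qed.

(** This reduces the theorem to a bijection on vertices and a count of arrows: arrows are matched
    along the fibres of the map to their pair of endpoints. *)
Lemma quiver_iso_card (Q Q' : quiver) (f : vert Q -> vert Q') :
  bijective f ->
  (forall i j, #|arrows_btw i j| = #|arrows_btw (f i) (f j)|) ->
  quiver_iso Q Q'.
Proof.
move=> bf e; have [f' fK f'K] := bf.
(* Endpoints in [Q'] are pulled back through [f'], so that both maps take values in pairs of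
   vertices of [Q]. *)
have [t|h bh hE] := bij_of_card_fibers (A := arrow Q) (B := arrow Q')
    (p := fun a => (src a, tgt a)) (q := fun b => (f' (src b), f' (tgt b))).
  have := e t.1 t.2; rewrite !card_sig => eQ.
  apply: etrans (etrans _ eQ) _; apply: eq_card => a; rewrite !inE.
    by rewrite [t]surjective_pairing xpair_eqE.
  by rewrite [t]surjective_pairing xpair_eqE !(can2_eq f'K fK).
by exists f, h; split=> // a; have [sE tE] := hE a; rewrite -?sE -?tE f'K.
Qed.

(** * Degrees, vertex idempotents and arrow spaces *)

Section PathAlg.
Variables (k : fieldType) (Q : quiver).
Implicit Types (x y : path_alg k Q) (p q : qpath Q).

Lemma pascaleAl (c : k) x y : (c *: x) * y = c *: (x * y).
Proof. by rewrite [RHS]pamulZl. Qed.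

Lemma pascaleAr (c : k) x y : x * (c *: y) = c *: (x * y).
Proof. by rewrite [RHS]pamulZr. Qed.

Lemma coef_zero p : coef p (0 : path_alg k Q) = 0.
Proof. exact: mcoeff0. Qed.

Lemma coefp_sum p I (r : seq I) (P : pred I) (F : I -> path_alg k Q) :
  coef p (\sum_(i <- r | P i) F i) = \sum_(i <- r | P i) coef p (F i).
Proof. exact: (big_morph (coef p) (Defs.coefD p) (coef_zero p)). Qed.

(** By linearity [x] may be taken to be a path, which the two idempotents keep or kill according to
    its endpoints. *)
Lemma coef_corner i j p x :
  coef p (evert k i * x * evert k j) =
  ((i == psrc p) && (j == ptgt p))%:R * coef p x.
Proof.
rewrite [x in LHS]path_algE [x in RHS]path_algE mulr_sumr mulr_suml !coefp_sum.
rewrite mulr_sumr; apply: eq_bigr => q _.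
rewrite pascaleAr pascaleAl !Defs.coefZ [in RHS]coef_pelt [RHS]mulrCA.
congr (_ * _).
rewrite -[evert k i * _]/(pamul _ _) pamul_elt pcat_vertl.
case: eqP => [iq|niq] /=; last first.
  rewrite mul0r coef_zero; case: (q =P p) => [<-|_]; last by rewrite mulr0.
  by move/eqP/negbTE: niq => ->; rewrite mul0r.
rewrite -[pelt k q * _]/(pamul _ _) pamul_elt pcat_vertr.
case: (q =P p) => [<-|/eqP/negbTE nqp].
  rewrite mulr1 iq eqxx /=.
  by case: eqP => _ /=; rewrite ?coef_pelt ?coef_zero ?eqxx.
by rewrite mulr0; case: eqP => _ /=; rewrite ?coef_pelt ?coef_zero ?nqp.
Qed.

Lemma homogeneousP n x :
  homogeneous n x <-> forall p, plen p != n -> coef p x = 0.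
Proof.
split=> [hx p np|hx p]; last first.
  rewrite -mcoeff_neq0 => px; apply/eqP; apply: contraNT px => /hx.
  by rewrite /coef => ->.
by apply/eqP; apply: contraNT np => px; apply/eqP/hx; rewrite -mcoeff_neq0.
Qed.

Lemma homogeneousD n x y :
  homogeneous n x -> homogeneous n y -> homogeneous n (x + y).
Proof.
move=> /homogeneousP hx /homogeneousP hy; apply/homogeneousP => p np.
by rewrite Defs.coefD hx // hy // addr0.
Qed.

Lemma homogeneousZ n c x : homogeneous n x -> homogeneous n (c *: x).
Proof.
move=> /homogeneousP hx; apply/homogeneousP => p np.
by rewrite Defs.coefZ hx // mulr0.
Qed.

Lemma homogeneous0 n : homogeneous n (0 : path_alg k Q).
Proof. by apply/homogeneousP => p _; rewrite coef_zero. Qed.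

Lemma homogeneous_sum n I (r : seq I) (P : pred I) (F : I -> path_alg k Q) :
  (forall i, P i -> homogeneous n (F i)) ->
  homogeneous n (\sum_(i <- r | P i) F i).
Proof.
move=> hF; apply: big_ind => //; first exact: homogeneous0.
by move=> x y; exact: homogeneousD.
Qed.

Lemma homogeneous_pelt p : homogeneous (plen p) (pelt k p).
Proof.
apply/homogeneousP => q qp; rewrite coef_pelt.
by case: (p =P q) qp => // ->; rewrite eqxx.
Qed.

Lemma homogeneous_earrow a : homogeneous 1 (earrow k a : path_alg k Q).
Proof. exact: homogeneous_pelt. Qed.

Lemma evertM i j : evert k i * evert k j = (i == j)%:R *: evert k i :> path_alg k Q.
Proof.
rewrite -[LHS]/(pamul _ _) pamul_elt pcat_vertl [psrc _]/=.
by case: eqP => [->|_]; rewrite ?scale1r ?scale0r.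
Qed.

Lemma evertK i : evert k i * evert k i = evert k i :> path_alg k Q.
Proof. by rewrite evertM eqxx scale1r. Qed.

Lemma evert_neq0 i : evert k i != 0 :> path_alg k Q.
Proof.
apply/eqP => /(congr1 (coef (pvert i))).
by rewrite coef_pelt eqxx coef_zero => /eqP; rewrite oner_eq0.
Qed.

(** The space E_ij described by degree and idempotents instead of its basis of arrows, a form that
    is visibly preserved by algebra automorphisms respecting degrees. *)
Definition in_arrow_space (i j : vert Q) x :=
  homogeneous 1 x /\ evert k i * x * evert k j = x.

Lemma arrow_spaceE i j x : in_arrow_space i j x ->
  x = \sum_(a : arrows_btw i j) coef (parrow (val a)) x *: earrow k (val a).
Proof.
case=> /homogeneousP h1 xE; apply: path_algP => p; rewrite coefp_sum.
under eq_bigr => a _ do rewrite Defs.coefZ coef_pelt.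
case: (boolP [exists a : arrows_btw i j, p == parrow (val a)]).
  case/existsP=> a /eqP ->; rewrite (bigD1 a) //= eqxx mulr1 big1 ?addr0 // => b.
  move=> nba; case: eqP => [|_]; last by rewrite mulr0.
  move/(congr1 (@pseq Q)) => -[] /val_inj ab.
  by rewrite ab eqxx in nba.
rewrite negb_exists => /forallP np.
rewrite big1 => [|a _]; last first.
  by rewrite eq_sym (negbTE (np a)) mulr0.
(* For a path that is not an arrow from i to j the coefficient vanishes: by degree if the length is
   not 1, by the idempotents if the endpoints are wrong. No other case is left. *)
have [pl|/h1 //] := eqVneq (plen p) 1%N.
rewrite -xE coef_corner.
case: eqP => [ip|_]; last by rewrite mul0r.
case: eqP => [jp|_]; last by rewrite mul0r.
have : walk (psrc p) (pseq p) by exact: (valP p).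
move: pl; rewrite /plen; case ps: (pseq p) => [|a [|]] // _ /=; rewrite andbT => sa.
have ap : p = parrow a.
  by apply: qpathP => //; rewrite -(eqP sa).
have aij : (src a == i) && (tgt a == j).
  by rewrite ip jp ap /ptgt /= !eqxx.
by have := np (exist _ a aij); rewrite ap eqxx.
Qed.

Lemma in_arrow_space_earrow i j (a : arrows_btw i j) :
  in_arrow_space i j (earrow k (val a)).
Proof.
split; first exact: homogeneous_earrow.
apply: path_algP => p; rewrite coef_corner coef_pelt.
case: (parrow _ =P p) => [<-|]; rewrite ?mulr0 // mulr1 /ptgt /psrc /=.
by case: a => a /= /andP[/eqP -> /eqP ->]; rewrite !eqxx.
Qed.

Lemma in_arrow_spaceD i j x y :
  in_arrow_space i j x -> in_arrow_space i j y -> in_arrow_space i j (x + y).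
Proof.
case=> hx ex [hy ey]; split; first exact: homogeneousD.
by rewrite mulrDr mulrDl ex ey.
Qed.

Lemma in_arrow_spaceZ i j c x :
  in_arrow_space i j x -> in_arrow_space i j (c *: x).
Proof.
case=> hx ex; split; first exact: homogeneousZ.
by rewrite pascaleAr pascaleAl ex.
Qed.

Lemma in_arrow_space_sum i j I (r : seq I) (P : pred I) (F : I -> path_alg k Q) :
  (forall t, P t -> in_arrow_space i j (F t)) ->
  in_arrow_space i j (\sum_(t <- r | P t) F t).
Proof.
move=> hF; apply: big_ind => //; last by move=> x y; exact: in_arrow_spaceD.
by split; [exact: homogeneous0|rewrite mulr0 mul0r].
Qed.

Lemma free_earrow i j (l : arrows_btw i j -> k) :
  \sum_a l a *: (earrow k (val a) : path_alg k Q) = 0 -> forall a, l a = 0.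
Proof.
move=> /(congr1 (coef (parrow _))) l0 a; have {l0} := l0 (val a).
rewrite coef_zero coefp_sum (bigD1 a) //= big1.
  by rewrite addr0 Defs.coefZ coef_pelt eqxx mulr1.
move=> b nba; rewrite Defs.coefZ coef_pelt; case: eqP => [|_]; last by rewrite mulr0.
move/(congr1 (@pseq Q)) => -[] /val_inj ab.
by rewrite ab eqxx in nba.
Qed.

(** Both [u] and the arrows are bases of the same space, so [leq_card_free] applies in both
    directions. *)
Lemma card_arrow_space i j (A : finType) (u : A -> path_alg k Q) :
  (forall l : A -> k, \sum_a l a *: u a = 0 -> forall a, l a = 0) ->
  (forall a, in_arrow_space i j (u a)) ->
  (forall x, in_arrow_space i j x -> exists l : A -> k, x = \sum_a l a *: u a) ->
  #|A| = #|arrows_btw i j|.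
Proof.
move=> fu uE genu; apply/eqP; rewrite eqn_leq; apply/andP; split.
  apply: (leq_card_free (v := fun a : arrows_btw i j => earrow k (val a)) fu).
  by move=> a; exists (fun b => coef (parrow (val b)) (u a)); exact: arrow_spaceE.
apply: (leq_card_free (u := fun a : arrows_btw i j => earrow k (val a)) (v := u)).
  exact: free_earrow.
by move=> a; apply: genu; exact: in_arrow_space_earrow.
Qed.

Lemma coef_comb_earrow i j (l : 'I_#|arrows_btw i j| -> k) r :
  coef (parrow (val (enum_val r)))
    (\sum_t l t *: (earrow k (val (enum_val t)) : path_alg k Q)) = l r.
Proof.
rewrite coefp_sum (bigD1 r) //= big1.
  by rewrite addr0 Defs.coefZ coef_pelt eqxx mulr1.
move=> t nt; rewrite Defs.coefZ coef_pelt.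
case: eqP => [/(congr1 (@pseq Q)) [] /val_inj /enum_val_inj e|_].
  by rewrite e eqxx in nt.
by rewrite mulr0.
Qed.

Lemma arrow_space_eq i j (u v : path_alg k Q) :
  in_arrow_space i j u -> in_arrow_space i j v ->
  (forall r : 'I_#|arrows_btw i j|, coef (parrow (val (enum_val r))) u =
             coef (parrow (val (enum_val r))) v) -> u = v.
Proof.
move=> /arrow_spaceE uE /arrow_spaceE vE e; rewrite uE vE.
by apply: eq_bigr => a _; rewrite -[a]enum_rankK e.
Qed.

End PathAlg.

(** * Self-duality of a finite abelian group *)

(** Symmetry carries multiplicativity over to the second argument. The last clause is nondegeneracy:
    distinct elements h give distinct characters [chi _ h]. *)
Definition perfect_pairing (k : fieldType) (gT : finGroupType)
    (chi : gT -> gT -> k) : Prop :=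
  [/\ forall g g' h, chi (g * g')%g h = chi g h * chi g' h,
      forall h, chi 1%g h = 1,
      forall g h, chi g h = chi h g
    & forall h, (forall g, chi g h = 1) -> h = 1%g].

Section Pairing.
Variables (k : fieldType) (gT : finGroupType) (chi : gT -> gT -> k).
Hypothesis pchi : perfect_pairing chi.
Hypothesis nzG : #|gT|%:R != 0 :> k.

Lemma pairMl g g' h : chi (g * g')%g h = chi g h * chi g' h.
Proof. by case: pchi. Qed.

Lemma pair1l h : chi 1%g h = 1.
Proof. by case: pchi. Qed.

Lemma pairC g h : chi g h = chi h g.
Proof. by case: pchi. Qed.

Lemma pairMr g h h' : chi g (h * h')%g = chi g h * chi g h'.
Proof. by rewrite !(pairC g) pairMl. Qed.

Lemma pair1r g : chi g 1%g = 1.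
Proof. by rewrite pairC pair1l. Qed.

Lemma pairVl g h : chi g h * chi g^-1%g h = 1.
Proof. by rewrite -pairMl mulgV pair1l. Qed.

Lemma pair_neq0 g h : chi g h != 0.
Proof.
by apply/eqP=> c0; have /eqP := pairVl g h; rewrite c0 mul0r eq_sym oner_eq0.
Qed.

(** Orthogonality: for h other than 1, nondegeneracy gives a g with [chi g h != 1], and translating
    the sum by g multiplies it by this factor. *)
Lemma sum_pair h : \sum_g chi g h = #|gT|%:R *+ (h == 1%g).
Proof.
have [->|nh] := eqVneq h 1%g.
  by rewrite mulr1n -sumr_const; apply: eq_bigr => g _; rewrite pair1r.
have [g ng|c1] := pickP (fun g => chi g h != 1); last first.
  case/eqP: nh; case: pchi => _ _ _; apply=> g.
  by apply/eqP/negbFE/c1.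
rewrite mulr0n; apply/eqP.
have e : \sum_g chi g h = chi g h * \sum_g chi g h.
  rewrite [LHS](reindex_inj (mulgI g)) mulr_sumr.
  by apply: eq_bigr => g' _; rewrite pairMl.
have : (1 - chi g h) * (\sum_g chi g h) = 0.
  by rewrite mulrBl mul1r -e subrr.
by move/eqP; rewrite mulf_eq0 subr_eq0 eq_sym (negbTE ng).
Qed.

(** Fourier inversion: summing the transform of [phi] against [chi g0^-1 h] over h leaves [phi g0]
    times the order of the group. *)
Lemma fourier_inj (phi : gT -> k) :
  (forall h, \sum_g phi g * chi g h = 0) -> forall g, phi g = 0.
Proof.
move=> phi0 g0; apply: (mulIf nzG); rewrite mul0r.
have : \sum_h (\sum_g phi g * chi g h) * chi g0^-1%g h = 0.
  by rewrite big1 // => h _; rewrite phi0 mul0r.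
move=> <-; under [RHS]eq_bigr => h _ do rewrite mulr_suml.
rewrite exchange_big (bigD1 g0) //= [X in _ + X]big1 ?addr0 => [|g ng].
  under eq_bigr => h _ do rewrite -mulrA pairVl mulr1.
  by rewrite sumr_const mulr_natr.
under eq_bigr => h _ do rewrite -mulrA -pairMl pairC.
rewrite -mulr_sumr sum_pair; case: eqP => [e|]; last by rewrite mulr0.
by move: ng; rewrite eq_mulgV1 e eqxx.
Qed.

(** If [f h] is nonzero, translating its sum by g in H forces [chi g h = tau g]. Some [f h] is
    nonzero, since otherwise the inverse of [tau], extended by 0 outside H, would have zero Fourier
    transform although its value at 1 is 1. *)
Lemma pair_extends (H : {group gT}) (tau : gT -> k) :
  tau 1%g = 1 -> {in H &, {morph tau : g h / (g * h)%g >-> g * h}} ->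
  exists h, {in H, forall g, chi g h = tau g}.
Proof.
move=> t1 tM; pose f h := \sum_(g in H) tau g^-1%g * chi g h.
have [h nh|f0] := pickP (fun h => f h != 0); last first.
  have := @fourier_inj (fun g => if g \in H then tau g^-1%g else 0).
  move=> /(_ _ 1%g); rewrite group1 invg1 t1 => /(_ _)/eqP; rewrite oner_eq0.
  suff P h : \sum_g (if g \in H then tau g^-1%g else 0) * chi g h = 0.
    by move=> /(_ P).
  have /negbFE/eqP e := f0 h; rewrite -[RHS]e /f [RHS]big_mkcond.
  by apply: eq_bigr => g _; case: ifP; rewrite ?mul0r.
exists h => g gH; apply: (mulIf nh).
rewrite !mulr_sumr [RHS](reindex_inj (mulgI g)) /=.
apply: eq_big => [g'|g' g'H]; first by rewrite groupMl.
have e : tau g * tau g^-1%g = 1 by rewrite -tM ?groupV // mulgV.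
rewrite invMg tM ?groupV // pairMl -[LHS]mul1r -e; ring.
Qed.

(** If a were outside H, the indicator of H minus that of the coset aH would be 1 at 1. Its
    transform at g is [1 - chi a g] times the sum of [chi h g] over H. The first factor vanishes for
    g orthogonal to H, the second for every other g. *)
Lemma double_orthogonal (H : {group gT}) a :
  (forall g, {in H, forall h, chi g h = 1} -> chi g a = 1) -> a \in H.
Proof.
move=> aP; apply: contraT => naH.
have := @fourier_inj (fun h => (h \in H)%:R - ((a^-1 * h)%g \in H)%:R).
move=> /(_ _ 1%g); rewrite group1 mulg1 groupV (negbTE naH) subr0.
suff P g : \sum_h ((h \in H)%:R - ((a^-1 * h)%g \in H)%:R) * chi h g = 0.
  by move=> /(_ P) /eqP; rewrite oner_eq0.
under eq_bigr => h _ do rewrite mulrBl.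
rewrite sumrB [X in _ - X](reindex_inj (mulgI a)) /=.
under [X in _ - X]eq_bigr => h _ do rewrite mulKg pairMl mulrCA.
rewrite -mulr_sumr -[X in X - _]mul1r -mulrBl.
have [/forall_inP gH|] := boolP [forall h in H, chi g h == 1].
  rewrite (pairC a) aP ?subrr ?mul0r // => h /gH /eqP //.
rewrite negb_forall => /existsP[h]; rewrite negb_imply => /andP[hH nh].
suff -> : \sum_h (h \in H)%:R * chi h g = 0 by rewrite mulr0.
apply/eqP; set s := \sum_h _.
have e : s = chi g h * s.
  rewrite /s [LHS](reindex_inj (mulgI h)) mulr_sumr; apply: eq_bigr => h' _.
  by rewrite groupMl // pairMl mulrCA (pairC g).
have : (1 - chi g h) * s = 0 by rewrite mulrBl mul1r -e subrr.
by move/eqP; rewrite mulf_eq0 subr_eq0 eq_sym (negbTE nh).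
Qed.

End Pairing.

(** Every element is a product of powers of the generators, so the first three clauses become
    identities between exponents. For nondegeneracy, pairing h with each generator shows that its
    order divides the corresponding exponent of h. *)
Lemma perfect_pairing_of_generators (k : fieldType) (gT : finGroupType)
  (habelian : abelian [set: gT]) (n : nat) (gen : 'I_n -> gT)
  (hgen : \big[dprod/1%g]_(l < n) <[gen l]>%g = [set: gT])
  (xi : 'I_n -> k)
  (hxi : forall l : 'I_n, #[gen l]%g.-primitive_root (xi l))
  (chi : gT -> gT -> k)
  (hchi : forall t s : 'I_n -> nat,
     chi (\prod_(l < n) gen l ^+ t l)%g (\prod_(l < n) gen l ^+ s l)%g
     = \prod_(l < n) xi l ^+ (t l * s l)%N) :
  perfect_pairing chi.
Proof.
have cG (x y : gT) : commute x y by apply: (centsP habelian); rewrite inE.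
have genP x : exists t : 'I_n -> nat, x = (\prod_(l < n) gen l ^+ t l)%g.
  have [|c [cP -> _]] := @mem_bigdprod _ _ _ _ _ x hgen; first by rewrite inE.
  have /fin_all_exists[t tP] (l : 'I_n) : exists m, c l = (gen l ^+ m)%g.
    by have /cycleP := cP l isT.
  by exists t; apply: eq_bigr => l _; rewrite tP.
have genM (s t : 'I_n -> nat) :
    ((\prod_(l < n) gen l ^+ s l) * \prod_(l < n) gen l ^+ t l)%g
    = (\prod_(l < n) gen l ^+ (s l + t l))%g.
  symmetry; apply: (big_rec3 (fun x y z => z = x * y)%g).
    by rewrite mulg1.
  move=> l x y _ _ ->; rewrite expgD -!mulgA; congr (_ * _)%g.
  by rewrite !mulgA; congr (_ * _)%g; exact: cG.
split.
- move=> g g' h; have [[s ->] [t ->] [u ->]] := And3 (genP g) (genP g') (genP h).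
  rewrite genM !hchi -big_split; apply: eq_bigr => l _.
  by rewrite mulnDl exprD.
- move=> h; have [s ->] := genP h.
  have := hchi (fun=> 0%N) s; rewrite /= [X in chi X]big1 // => ->.
  by rewrite big1.
- move=> g h; have [[s ->] [t ->]] := conj (genP g) (genP h).
  by rewrite !hchi; apply: eq_bigr => l _; rewrite mulnC.
move=> h; have [s ->] := genP h => c1.
apply: big1 => l _.
(* With the indicator of l as exponents this product is [gen l], in the shape that [hchi]
   expects. *)
have := c1 (\prod_(l' < n) gen l' ^+ (l' == l))%g.
rewrite hchi (bigD1 l) //= eqxx mul1n big1 => [|l' /negbTE ->]; last first.
  by rewrite mul0n.
rewrite mulr1 => /eqP; rewrite -(prim_order_dvd (hxi l)).
by rewrite order_dvdn => /eqP.
Qed.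

(** * Skew group algebras *)

Section Skew.
Variables (k : fieldType) (gT : finGroupType) (Q : quiver).
Variable act : quiver_action k gT Q.
Local Notation S := (skew_alg act).
Implicit Types (z w : S) (x y : path_alg k Q).

Lemma qactZ g c x : act g (c *: x) = c *: act g x.
Proof. by rewrite -[c *: x]addr0 qact_linear qact0 addr0. Qed.

Lemma qact_sum g I (r : seq I) (P : pred I) (F : I -> path_alg k Q) :
  act g (\sum_(i <- r | P i) F i) = \sum_(i <- r | P i) act g (F i).
Proof. exact: (big_morph (act g) (@qactD _ _ _ act g) (qact0 act g)). Qed.

Lemma in_arrow_space_qact g i j x : in_arrow_space i j x ->
  in_arrow_space (vact act g i) (vact act g j) (act g x).
Proof.
move=> [hx ex]; split; first exact: qact_arrow.
by rewrite -!qact_vert -!qact_mul ex.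
Qed.

Lemma sk_funZ c z g : sk_fun (c *: z) g = c *: sk_fun z g.
Proof. exact: ffunE. Qed.

Lemma sk_fun0 g : sk_fun (0 : S) g = 0.
Proof. exact: ffunE. Qed.

Lemma sk_fun_sum g I (r : seq I) (P : pred I) (F : I -> S) :
  sk_fun (\sum_(i <- r | P i) F i) g = \sum_(i <- r | P i) sk_fun (F i) g.
Proof.
exact: (big_morph (fun z : S => sk_fun z g)
  (fun z w => skD z w g) (sk_fun0 g)).
Qed.

Lemma sk_funM z w g :
  sk_fun (z * w) g = \sum_h sk_fun z h * act h (sk_fun w (h^-1 * g)%g).
Proof. exact: skE. Qed.

Lemma skscaleAl (c : k) z w : (c *: z) * w = c *: (z * w).
Proof.
apply: skewP => g; rewrite sk_funZ !sk_funM scaler_sumr.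
by apply: eq_bigr => h _; rewrite sk_funZ pascaleAl.
Qed.

Lemma skscaleAr (c : k) z w : z * (c *: w) = c *: (z * w).
Proof.
apply: skewP => g; rewrite sk_funZ !sk_funM scaler_sumr.
by apply: eq_bigr => h _; rewrite sk_funZ qactZ pascaleAr.
Qed.

Lemma sk_fun_stens x g h : sk_fun (stens act x g) h = if h == g then x else 0.
Proof. exact: skE. Qed.

Lemma stensM x y g h :
  stens act x g * stens act y h = stens act (x * act g y) (g * h)%g.
Proof.
apply: skewP => u; rewrite sk_funM (bigD1 g) //= big1 ?addr0 => [|v /negbTE nv].
  rewrite !sk_fun_stens eqxx.
  have -> : (g^-1 * u == h)%g = (u == g * h)%g.
    by rewrite (can2_eq (mulKVg g) (mulKg g)).
  by case: eqP => _; rewrite ?qact0 ?mulr0.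
by rewrite sk_fun_stens nv mul0r.
Qed.

Lemma sk_fun_stens1l x z g : sk_fun (stens act x 1%g * z) g = x * sk_fun z g.
Proof.
rewrite sk_funM (bigD1 1%g) //= big1 ?addr0 => [|v /negbTE nv].
  by rewrite sk_fun_stens eqxx invg1 mul1g qact1.
by rewrite sk_fun_stens nv mul0r.
Qed.

Lemma sk_fun_stens1r x z g : sk_fun (z * stens act x 1%g) g = sk_fun z g * act g x.
Proof.
rewrite sk_funM (bigD1 g) //= big1 ?addr0 => [|v /negbTE nv].
  by rewrite sk_fun_stens mulVg eqxx.
by rewrite sk_fun_stens -eq_mulVg1 nv qact0 mulr0.
Qed.

Lemma stensZ c x g : stens act (c *: x) g = c *: stens act x g.
Proof.
apply: skewP => h; rewrite sk_funZ !sk_fun_stens.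
by case: eqP => // _; rewrite scaler0.
Qed.

Lemma stens_sum g I (r : seq I) (P : pred I) (F : I -> path_alg k Q) :
  stens act (\sum_(i <- r | P i) F i) g = \sum_(i <- r | P i) stens act (F i) g.
Proof.
apply: skewP => h; rewrite [RHS]sk_fun_sum sk_fun_stens.
case: eqP => [->|/eqP/negbTE hg].
  by apply: eq_bigr => i _; rewrite sk_fun_stens eqxx.
by rewrite big1 // => i _; rewrite sk_fun_stens hg.
Qed.

(** * Twisting by characters and Fourier inversion *)

Section Twist.
Variable chi : gT -> gT -> k.
Hypothesis pchi : perfect_pairing chi.
Local Notation twist := (char_twist chi).

Lemma sk_fun_twist g z h : sk_fun (twist g z) h = chi g h *: sk_fun z h.
Proof. exact: skE. Qed.

Lemma twistM g z w : twist g (z * w) = twist g z * twist g w.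
Proof.
apply: skewP => u; rewrite sk_fun_twist !sk_funM scaler_sumr.
apply: eq_bigr => h _; rewrite [X in _ = X * _]sk_fun_twist.
rewrite [X in _ = _ * act _ X]sk_fun_twist.
by rewrite qactZ pascaleAl pascaleAr scalerA -(pairMr pchi) mulKVg.
Qed.

Lemma twistZ g c z : twist g (c *: z) = c *: twist g z.
Proof.
apply: skewP => h; rewrite [LHS]sk_fun_twist [RHS]sk_funZ.
by rewrite [X in _ *: X = _]sk_funZ [X in _ = _ *: X]sk_fun_twist !scalerA mulrC.
Qed.

Lemma twist_stens g x h : twist g (stens act x h) = chi g h *: stens act x h.
Proof.
apply: skewP => u; rewrite [LHS]sk_fun_twist [RHS]sk_funZ sk_fun_stens.
by case: eqP => [->|_]; last rewrite !scaler0.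
Qed.

(** At u the left side has the factor [chi g (h^-1 * u)] summed over g, which vanishes by
    orthogonality unless u = h. Homogeneous components are thus combinations of twists. *)
Lemma fourier_component (z : S) h :
  \sum_g chi g h^-1%g *: twist g z = #|gT|%:R *: stens act (sk_fun z h) h.
Proof.
apply: skewP => u; rewrite [LHS]sk_fun_sum [RHS]sk_funZ [in RHS]sk_fun_stens.
under eq_bigr => g _.
  rewrite sk_funZ [X in _ *: X]sk_fun_twist scalerA -(pairMr pchi); over.
rewrite -scaler_suml (sum_pair pchi) -eq_mulVg1 eq_sym.
by case: eqP => [->|_]; [rewrite mulr1n|rewrite mulr0n scale0r scaler0].
Qed.

End Twist.
End Skew.

Lemma transversal_properties (T : finType) (X : {set T}) (P : {set {set T}})
    (D : {set T}) : is_transversal X P D ->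
  [/\ X \subset D,
      forall B, B \in P -> exists2 x, x \in X & x \in B
    & forall B x y, B \in P -> x \in X -> y \in X -> x \in B -> y \in B -> x = y].
Proof.
case/and3P=> _ sXD /forall_inP trX; split=> // [B|B x y] /trX/cards1P[z zE].
  have: z \in X :&: B by rewrite zE set11.
  by rewrite inE => /andP[]; exists z.
move=> xX yX xB yB; have: x \in X :&: B by rewrite inE xX.
have: y \in X :&: B by rewrite inE yX.
by rewrite zE !inE => /eqP -> /eqP ->.
Qed.

(** * Linear representations *)

(** Irreducible representations will have degree 1 only up to a propositional equality; the trace,
    meaningful for every d, then serves as the character and avoids casts. *)
Lemma mx_trace1 (k : fieldType) d (A : 'M[k]_d) : d = 1%N -> A = (\tr A)%:M.
Proof.
by move=> e; move: A; rewrite e => A; rewrite [A in LHS]mx11_scalar trace_mx11.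
Qed.

Section LinearReps.
Variables (k : fieldType) (gT : finGroupType) (H : {group gT}).

Lemma trace_mx_rsim d1 d2 (rho1 : mx_representation k H d1)
    (rho2 : mx_representation k H d2) :
  d1 = 1%N -> mx_rsim rho1 rho2 -> {in H, forall g, \tr (rho1 g) = \tr (rho2 g)}.
Proof.
move=> e1 [B e2 freeB rE] g gH; have := rE g gH.
have {}e2 : d2 = 1%N by rewrite -e2.
rewrite {1}[rho1 g]mx_trace1 // {1}[rho2 g]mx_trace1 //.
move: (\tr _) (\tr _) => a b; move: B freeB {rE}; rewrite e1 e2 => B freeB.
rewrite mul_scalar_mx mul_mx_scalar => /eqP; rewrite -subr_eq0 -scalerBl scaler_eq0.
case/orP=> [/eqP/subr0_eq //|/eqP B0].
by move: freeB; rewrite B0 /row_free mxrank0.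
Qed.

Lemma mx_rsim_trace d1 d2 (rho1 : mx_representation k H d1)
    (rho2 : mx_representation k H d2) :
  d1 = 1%N -> d2 = 1%N -> {in H, forall g, \tr (rho1 g) = \tr (rho2 g)} ->
  mx_rsim rho1 rho2.
Proof.
move=> e1 e2 te; exists (const_mx 1); first by rewrite e1 e2.
  move: rho1 rho2 te; rewrite e1 e2 => _ _ _.
  rewrite /row_free [const_mx 1](_ : _ = 1%:M) ?mxrank1 //.
  by apply/matrixP => i j; rewrite !mxE !ord1.
move=> g gH; rewrite [rho1 g]mx_trace1 // [rho2 g]mx_trace1 // te //.
by rewrite mul_scalar_mx mul_mx_scalar.
Qed.

Lemma trace_repr1 d (rho : mx_representation k H d) : d = 1%N -> \tr (rho 1%g) = 1.
Proof. by move=> e; rewrite repr_mx1 mxtrace1 e. Qed.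

Lemma trace_reprM d (rho : mx_representation k H d) : d = 1%N ->
  {in H &, {morph (fun g => \tr (rho g)) : g h / (g * h)%g >-> g * h}}.
Proof.
move=> e g h gH hH; rewrite repr_mxM // [rho g in LHS]mx_trace1 //.
by rewrite mul_scalar_mx mxtraceZ.
Qed.

Lemma trace_repr_neq0 d (rho : mx_representation k H d) g :
  d = 1%N -> g \in H -> \tr (rho g) != 0.
Proof.
move=> e gH; apply/eqP => t0; have := trace_repr1 rho e.
rewrite -(mulgV g) trace_reprM ?groupV // t0 mul0r => /eqP.
by rewrite eq_sym oner_eq0.
Qed.

Lemma linear_repr_irr (tau : gT -> k) :
  tau 1%g = 1 -> {in H &, {morph tau : g h / (g * h)%g >-> g * h}} ->
  exists2 rho : mx_representation k H 1, mx_irreducible rho &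
    forall g, \tr (rho g) = tau g.
Proof.
move=> t1 tM; have rP : mx_repr H (fun g => (tau g)%:M : 'M_1).
  by split=> [|g h gH hH]; rewrite ?t1 // tM // scalar_mxM.
exists (MxRepresentation rP); last by move=> g; rewrite mxtrace_scalar.
exact/mx_abs_irrW/linear_mx_abs_irr.
Qed.

End LinearReps.

Section Intertwiner.
Variables (k : fieldType) (a d1 d2 : nat) (i0 : 'I_d1) (j0 : 'I_d2).
Hypotheses (e1 : d1 = 1%N) (e2 : d2 = 1%N).

Lemma mx_coordP (X Y : 'M[k]_(d2 * a, d1)) :
  (forall r, X (mxtens_index (j0, r)) i0 = Y (mxtens_index (j0, r)) i0) -> X = Y.
Proof.
have d1P (i i' : 'I_d1) : i = i' by move: i i'; rewrite e1 => i i'; rewrite !ord1.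
have d2P (i i' : 'I_d2) : i = i' by move: i i'; rewrite e2 => i i'; rewrite !ord1.
move=> XY; apply/matrixP => q i; rewrite (d1P i i0) -[q]mxtens_unindexK.
by case: (mxtens_unindex q) => j r; rewrite (d2P j j0).
Qed.

(** Since [d1] and [d2] are 1, X amounts to a column indexed by r, and the intertwining condition
    becomes an eigenvector equation for A. *)
Lemma tens_intertwinerP (t u : k) (A : 'M_a) (X : 'M_(d2 * a, d1)) :
  (u%:M *t A) *m X = X *m t%:M <->
  forall r, u * (\sum_s A r s * X (mxtens_index (j0, s)) i0) =
            t * X (mxtens_index (j0, r)) i0.
Proof.
have d2P (i : 'I_d2) : i = j0.
  by move: (i) (j0); rewrite e2 => i' j'; rewrite !ord1.
have coordE r : ((u%:M *t A) *m X) (mxtens_index (j0, r)) i0 =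
    u * (\sum_s A r s * X (mxtens_index (j0, s)) i0).
  rewrite mxE mulr_sumr (reindex (@mxtens_index d2 a)) /=; last first.
    by exists (@mxtens_unindex d2 a) => ? _; rewrite ?mxtens_indexK ?mxtens_unindexK.
  rewrite (eq_bigr (fun q => u * (A r q.2 * X (mxtens_index (j0, q.2)) i0))).
    rewrite -(pair_big xpredT xpredT
      (fun _ s => u * (A r s * X (mxtens_index (j0, s)) i0))).
    rewrite /= (bigD1 j0) //= [X in _ + X]big1 ?addr0 // => j.
    by rewrite (d2P j) eqxx.
  move=> [j s] _ /=; rewrite (d2P j) tensmxE mxE eqxx mulr1n.
  by rewrite mulrA.
split=> [e r|e]; first by rewrite -coordE e mul_mx_scalar mxE.
by apply: mx_coordP => r; rewrite coordE e mul_mx_scalar mxE.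
Qed.

End Intertwiner.

(** * The corner of the skew group algebra *)

Section Homogeneous.
Variables (k : fieldType) (Q : quiver).
Implicit Types (x y : path_alg k Q).

Lemma homogeneousM m n x y :
  homogeneous m x -> homogeneous n y -> homogeneous (m + n) (x * y).
Proof.
move=> hx hy; rewrite -[x * y]/(pamul x y) pamul.unlock big_seq.
apply: homogeneous_sum => p /hx px; rewrite big_seq.
apply: homogeneous_sum => q /hy qy; apply: homogeneousZ.
case: (pcatP p q) => [r _ _ _ rE|_] /=; last exact: homogeneous0.
rewrite -px -qy -(size_cat (pseq p)) -rE; exact: homogeneous_pelt.
Qed.

Lemma homogeneous_evert i : homogeneous 0 (evert k i : path_alg k Q).
Proof. exact: homogeneous_pelt. Qed.

End Homogeneous.

(** Degree 0 is spanned by the vertex idempotents, which the action permutes. *)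
Lemma homogeneous0_qact (k : fieldType) (gT : finGroupType) (Q : quiver)
    (act : quiver_action k gT Q) g (x : path_alg k Q) :
  homogeneous 0 x -> homogeneous 0 (act g x).
Proof.
move=> hx; rewrite [x]path_algE qact_sum big_seq.
apply: homogeneous_sum => p /hx; rewrite /plen => /size0nil ps.
rewrite qactZ; apply: homogeneousZ.
have -> : p = pvert (psrc p) by exact: qpathP.
by rewrite -[pelt _ _]/(evert k (psrc p)) qact_vert; exact: homogeneous_evert.
Qed.

Lemma mc_verts_uniq (k : fieldType) (gT : finGroupType) (Q : quiver)
    (act : quiver_action k gT Q) (c : mckay_choice act) i j :
  i \in mc_verts c -> j \in mc_verts c -> j \in vorbit act i -> i = j.
Proof.
have [_ _ u] := transversal_properties (mc_vertsP c).
move=> iX jX ij; apply: (u (vorbit act i)) => //; first exact: imset_f.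
by apply/imsetP; exists 1%g; rewrite ?vact1.
Qed.

Section Corner.
Variables (k : fieldType) (gT : finGroupType) (Q : quiver).
Variable act : quiver_action k gT Q.
Hypothesis splitk : group_closure_field k gT.
Hypothesis abelG : abelian [set: gT].
Hypothesis nzG : #|gT|%:R != 0 :> k.
Variable chi : gT -> gT -> k.
Hypothesis pchi : perfect_pairing chi.
Variables (Qh : mckay act) (Phi : corner_iso Qh).

Local Notation S := (skew_alg act).
Local Notation V := (vert Qh).
Local Notation vtx := (fun x : V => mv_vert (x : mckay_vert (mk_choice Qh))).
Local Notation stab i := (vstab_group act i).
Local Notation ei i := (stens act (evert k i) 1%g).
Implicit Types (x y : V) (u v : path_alg k Qh).

Lemma ci_funD u v : Phi (u + v) = Phi u + Phi v.
Proof. by rewrite -[u]scale1r ci_linear !scale1r. Qed.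

Lemma ci_fun0 : Phi 0 = 0.
Proof. by apply: (addrI (Phi 0)); rewrite -ci_funD !addr0. Qed.

Lemma ci_funZ c u : Phi (c *: u) = c *: Phi u.
Proof. by rewrite -[c *: u]addr0 ci_linear ci_fun0 addr0. Qed.

Lemma ci_fun_sum I (r : seq I) (P : pred I) (F : I -> path_alg k Qh) :
  Phi (\sum_(i <- r | P i) F i) = \sum_(i <- r | P i) Phi (F i).
Proof. exact: (big_morph Phi ci_funD ci_fun0). Qed.

Lemma card_subgroup_neq0 (H : {group gT}) : #|H|%:R != 0 :> k.
Proof.
have /dvdnP[m] := cardSg (subsetT H).
by rewrite cardsT => e; apply: contraNneq nzG => H0; rewrite e natrM H0 mulr0.
Qed.

Lemma abelian_group (H : {group gT}) : abelian H.
Proof. exact: abelianS (subsetT H) abelG. Qed.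

Definition eps x : S := Phi (evert k x).

Lemma eps_neq0 x : eps x != 0.
Proof.
by apply/eqP; rewrite -ci_fun0 => /ci_inj/eqP; rewrite (negbTE (evert_neq0 k x)).
Qed.

Lemma epsM x y : eps x * eps y = (x == y)%:R *: eps x.
Proof. by rewrite -ci_mul evertM ci_funZ. Qed.

Lemma mv_deg1 (x : mckay_vert (mk_choice Qh)) : mv_deg x = 1%N.
Proof.
exact: (mx_irr_abelian_linear (splitk (G := _))
  (@irr_irreducible _ _ _ _ (mv_irr x)) (abelian_group _)).
Qed.

Lemma sk_fun_eps x a :
  sk_fun (eps x) a =
  (if a \in stab (vtx x) then
     #|stab (vtx x)|%:R^-1 * \tr (mv_rep (x : mckay_vert _) a^-1%g)
   else 0) *: evert k (vtx x).
Proof.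
have e : (mv_deg (x : mckay_vert (mk_choice Qh)))%:R = 1 :> k by rewrite mv_deg1.
rewrite /eps ci_vert sk_fun_stens1l /rep_idem sk_funZ sk_fun_sum e.
rewrite (eq_bigr (fun h => if a == h then
    \tr (mv_rep (x : mckay_vert _) h^-1%g) *: (1 : path_alg k Q) else 0)) => [|h _]; last first.
  by rewrite sk_funZ sk_fun_stens; case: eqP => _ //; rewrite scaler0.
rewrite pascaleAr mul1r.
case: ifP => [aH|aH].
  rewrite (bigD1 a aH) /= eqxx [X in _ + X]big1 => [|h /andP[_ ha]]; last first.
    by rewrite eq_sym (negbTE ha).
  by rewrite addr0 pascaleAr mulr1 scalerA.
rewrite big1 => [|h hH]; first by rewrite mulr0 scaler0 scale0r.
by case: eqP => [e'|//]; rewrite e' hH in aH.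
Qed.

Lemma eps1l x : ei (vtx x) * eps x = eps x.
Proof.
by apply: skewP => a; rewrite sk_fun_stens1l sk_fun_eps pascaleAr evertK.
Qed.

Lemma eps1r x : eps x * ei (vtx x) = eps x.
Proof.
apply: skewP => a; rewrite sk_fun_stens1r sk_fun_eps pascaleAl qact_vert.
case: ifP => [aH|_]; last by rewrite !scale0r.
by move: aH; rewrite inE => /eqP ->; rewrite evertK.
Qed.

Lemma homogeneous_eps x a : homogeneous 0 (sk_fun (eps x) a).
Proof. by rewrite sk_fun_eps; apply/homogeneousZ/homogeneous_evert. Qed.

Lemma corner_epsl x : corner_idem Qh * eps x = eps x.
Proof. by rewrite -(ci_one Phi) -ci_mul mul1r. Qed.

Lemma corner_epsr x : eps x * corner_idem Qh = eps x.
Proof. by rewrite -(ci_one Phi) -ci_mul mulr1. Qed.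

Lemma ci_fun_corner x y u : Phi (evert k x * u * evert k y) = eps x * Phi u * eps y.
Proof. by rewrite !ci_mul. Qed.

(* The part of a preimage in the degrees other than 1 is mapped to 0, because
   Phi respects degrees. *)
Lemma ci_fun_lift x y (z : S) : (forall g, homogeneous 1 (sk_fun z g)) ->
  eps x * z * eps y = z -> exists2 u, in_arrow_space x y u & Phi u = z.
Proof.
move=> hz zE; have [u uE] : exists u, Phi u = z.
  apply/ci_range; rewrite -zE !mulrA corner_epsl -!mulrA corner_epsr //.
pose u1 := \sum_(p <- msupp u | plen p == 1%N) coef p u *: pelt k p.
pose u2 := \sum_(p <- msupp u | plen p != 1%N) coef p u *: pelt k p.
have uu : u = u1 + u2 by rewrite {1}[u]path_algE (bigID (fun p => plen p == 1%N)).
have h1 : homogeneous 1 u1.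
  apply: homogeneous_sum => p /eqP <-; apply: homogeneousZ.
  exact: homogeneous_pelt.
have u20 : u2 = 0.
  apply: (@ci_inj _ _ _ _ _ Phi); rewrite ci_fun0; apply: skewP => g.
  rewrite sk_fun0; apply: path_algP => q; rewrite coef_zero.
  have [q1|q1] := eqVneq (plen q) 1%N.
    rewrite ci_fun_sum sk_fun_sum coefp_sum big1 // => p p1.
    rewrite ci_funZ sk_funZ Defs.coefZ.
    have /homogeneousP -> := @ci_graded _ _ _ _ _ Phi _ _ (@homogeneous_pelt k _ p) g.
      by rewrite mulr0.
    by rewrite q1 eq_sym.
  have -> : Phi u2 = z + (-1) *: Phi u1.
    by rewrite -uE uu ci_funD scaleN1r addrC addKr.
  rewrite skD sk_funZ Defs.coefD Defs.coefZ.
  have /homogeneousP -> // := hz g.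
  by have /homogeneousP -> // := @ci_graded _ _ _ _ _ Phi _ _ h1 g; rewrite mulr0 addr0.
exists u => //; split; first by rewrite uu u20 addr0.
by apply: (@ci_inj _ _ _ _ _ Phi); rewrite ci_fun_corner uE.
Qed.

(** * Orbits and stabilizers on the vertices of the McKay quiver *)

Variable acth : quiver_action k gT Qh.
Hypothesis hacth : forall g u, Phi (acth g u) = char_twist chi g (Phi u).

Lemma twist_eps g x : char_twist chi g (eps x) = eps (vact acth g x).
Proof. by rewrite /eps -hacth qact_vert. Qed.

(** The twist fixes e_i for i = [vtx x], so e_i is a left unit for [eps (g x)], and so is the
    idempotent of [vtx (g x)]. If the two vertices differed, their product 0 would kill
    [eps (g x)]. *)
Lemma vtx_vact g x : vtx (vact acth g x) = vtx x.
Proof.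
apply/eqP; apply: contraT => nx; have /eqP := eps_neq0 (vact acth g x); case.
rewrite -eps1l -twist_eps -{1}(eps1l x) twistM // twist_stens mulrA skscaleAr.
rewrite stensM qact1 evertM (negbTE nx) scale0r skscaleAl.
have -> : stens act 0 (1 * 1)%g = 0.
  by apply: skewP => h; rewrite sk_fun_stens sk_fun0; case: ifP.
by rewrite mul0r scaler0.
Qed.

(** This is [fourier_component] at h = 1, where the component of [eps x] is e_i divided by the order
    of G_i. The sum runs over the group, so each point of the orbit is counted with multiplicity. *)
Lemma sum_eps_orbit x :
  \sum_g eps (vact acth g x) = (#|gT|%:R / #|stab (vtx x)|%:R) *: ei (vtx x).
Proof.
have e : (mv_deg (x : mckay_vert (mk_choice Qh)))%:R = 1 :> k by rewrite mv_deg1.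
have := fourier_component pchi (eps x) 1%g.
rewrite sk_fun_eps group1 invg1 repr_mx1 mxtrace1 e mulr1 stensZ scalerA => <-.
by apply: eq_bigr => g _; rewrite pair1r // scale1r twist_eps.
Qed.

Lemma orbit_coef_neq0 x : #|gT|%:R / #|stab (vtx x)|%:R != 0 :> k.
Proof. by rewrite mulf_neq0 // invr_neq0 // card_subgroup_neq0. Qed.

(** Distinct [eps] are orthogonal: if y were outside the orbit of x, the orbit sum would annihilate
    [eps y], yet that sum is a nonzero multiple of e_i, a left unit for [eps y]. *)
Lemma vact_transitive x y : vtx x = vtx y -> exists g, vact acth g x = y.
Proof.
move=> xy; have [g /eqP|nxy] := pickP (fun g => vact acth g x == y).
  by exists g.
have : (\sum_g eps (vact acth g x)) * eps y = 0.
  rewrite mulr_suml big1 // => g _.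
  by rewrite epsM nxy scale0r.
rewrite sum_eps_orbit xy skscaleAl eps1l => /eqP.
by rewrite scaler_eq0 -xy (negbTE (orbit_coef_neq0 x)) (negbTE (eps_neq0 y)).
Qed.

Lemma eps_inj : injective eps.
Proof. by move=> x y /(@ci_inj _ _ _ _ _ Phi); exact: evert_inj. Qed.

(** The components of [eps x] are nonzero exactly on G_i, and the twist by g scales the one at a by
    [chi g a]. *)
Lemma mem_vstab_acth x g :
  (g \in vstab acth x) <-> {in stab (vtx x), forall a, chi g a = 1}.
Proof.
rewrite inE; split=> [/eqP gx a aH|ga].
  have := congr1 (fun z : S => sk_fun z a) (twist_eps g x).
  rewrite /= gx [LHS]sk_fun_twist sk_fun_eps aH scalerA => /eqP.
  rewrite -subr_eq0 -scalerBl scaler_eq0 (negbTE (evert_neq0 _ _)) orbF.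
  rewrite -{2}[_^-1 * _]mul1r -mulrBl mulf_eq0 subr_eq0 => /orP[/eqP //|].
  rewrite mulf_eq0 invr_eq0 (negbTE (card_subgroup_neq0 _)).
  by rewrite (negbTE (trace_repr_neq0 _ (mv_deg1 _) _)) ?groupV.
apply/eqP/eps_inj; rewrite -twist_eps; apply: skewP => a.
rewrite [LHS]sk_fun_twist sk_fun_eps; case: ifP => [aH|_].
  by rewrite (ga a aH) scale1r.
by rewrite !scale0r scaler0.
Qed.

Definition vact2 g (p : V * V) := (vact acth g p.1, vact acth g p.2).

Lemma vact2M g h p : vact2 (g * h)%g p = vact2 g (vact2 h p).
Proof. by rewrite /vact2 /= !vactM. Qed.

Lemma vact2_stab g p : (vact2 g p == p) = (g \in vstab acth p.1 :&: vstab acth p.2).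
Proof. by rewrite [p in RHS]surjective_pairing !inE -pair_eqE /=. Qed.

Lemma vstab_vact t x : vstab acth (vact acth t x) = vstab acth x.
Proof.
apply/setP => g; rewrite !inE -vactM.
have -> : (g * t)%g = (t * g)%g by apply: (centsP abelG); rewrite inE.
rewrite vactM; apply/eqP/eqP => [|-> //].
by move/(congr1 (vact acth t^-1)); rewrite -!(vactM acth t^-1 t) mulVg !vact1.
Qed.

(** * Eigenvectors over a pair of orbits versus arrows of the original quiver *)

Section ArrowSpace.
Variables (x0 y0 : V) (h : gT) (F : {set V * V}).
Hypothesis trF : is_transversal F
  [set vorbit2 acth p | p in setX (vorbit acth x0) (vorbit acth y0)]
  (setX (vorbit acth x0) (vorbit acth y0)).
Local Notation i := (vtx x0).
Local Notation j := (vtx y0).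

Lemma mem_transversal p : p \in F ->
  exists g g', p = (vact acth g x0, vact acth g' y0).
Proof.
have [sF _ _] := transversal_properties trF.
move=> /(subsetP sF); rewrite inE => /andP[/imsetP[g _ e] /imsetP[g' _ e']].
by exists g, g'; rewrite [p]surjective_pairing e e'.
Qed.

Lemma transversal_repr_ex g g' :
  exists2 p, p \in F & exists t, p = vact2 t (vact acth g x0, vact acth g' y0).
Proof.
have [_ rF _] := transversal_properties trF.
have [|p pF] := rF (vorbit2 acth (vact acth g x0, vact acth g' y0)).
  by apply: imset_f; apply/setXP; split; apply: imset_f.
by case/imsetP=> t _ pE; exists p => //; exists t.
Qed.

Lemma transversal_uniq p p' t : p \in F -> p' \in F -> p' = vact2 t p -> p = p'.
Proof.
have [sF _ uF] := transversal_properties trF => pF p'F e.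
apply: (uF (vorbit2 acth p)) => //.
- by apply: imset_f; exact: (subsetP sF).
- by apply/imsetP; exists 1%g; rewrite // !vact1 -surjective_pairing.
by apply/imsetP; exists t.
Qed.

Definition eigen_family (z : V * V -> path_alg k Qh) :=
  forall p, p \in F -> in_arrow_space p.1 p.2 (z p) /\
    {in vstab acth p.1 :&: vstab acth p.2, forall g, acth g (z p) = chi g h *: z p}.

Definition total_component (z : V * V -> path_alg k Qh) : path_alg k Q :=
  \sum_(p in F) sk_fun (Phi (z p)) h.

(** Each [Phi (z p)] is fixed by e_i on the left and e_j on the right; moving e_j past h in the
    h-component turns it into the idempotent of hj. *)
Lemma total_component_space z : eigen_family z ->
  in_arrow_space i (vact act h j) (total_component z).
Proof.
move=> ez; apply: in_arrow_space_sum => p pF; have [[zh zE] _] := ez p pF.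
have [g [g' pE]] := mem_transversal pF.
split; first exact: (@ci_graded _ _ _ _ _ Phi _ _ zh h).
have e : ei i * Phi (z p) * ei j = Phi (z p).
  rewrite -zE ci_fun_corner pE /= -(vtx_vact g x0) -(vtx_vact g' y0).
  by rewrite !mulrA eps1l -!mulrA eps1r.
by rewrite -{2}e sk_fun_stens1r sk_fun_stens1l qact_vert.
Qed.

(* Compressing the h-component, extracted by Fourier inversion, to a single
   pair p' recovers z p' up to the factor |G_p'|. *)
Lemma total_component_inj z : eigen_family z -> total_component z = 0 ->
  forall p, p \in F -> z p = 0.
Proof.
move=> ez z0 p' p'F.
have e0 : \sum_(p in F) \sum_g chi g h^-1%g *:
    (evert k p'.1 * acth g (z p) * evert k p'.2) = 0.
  apply: (@ci_inj _ _ _ _ _ Phi); rewrite ci_fun0 ci_fun_sum.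
  rewrite (eq_bigr (fun p => eps p'.1 *
      (#|gT|%:R *: stens act (sk_fun (Phi (z p)) h) h) * eps p'.2)) => [|p pF].
    rewrite -mulr_suml -mulr_sumr -scaler_sumr -stens_sum -/(total_component z) z0.
    have -> : stens act 0 h = 0 :> S.
      by apply: skewP => u; rewrite sk_fun_stens sk_fun0; case: ifP.
    by rewrite scaler0 mulr0 mul0r.
  rewrite ci_fun_sum -(fourier_component pchi) mulr_sumr mulr_suml.
  by apply: eq_bigr => g _; rewrite ci_funZ ci_fun_corner (hacth g (z p))
    [X in _ = X * _]skscaleAr [RHS]skscaleAl.
(* [acth g (z p)] lies in the arrow space of the pair g p, so compressing at p' keeps it or kills
   it. *)
have termE p g : p \in F -> evert k p'.1 * acth g (z p) * evert k p'.2 =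
    if vact2 g p == p' then acth g (z p) else 0.
  move=> pF; have [/(in_arrow_space_qact acth g)[_ <-] _] := ez p pF.
  rewrite !mulrA evertM -!mulrA evertM.
  have -> : (vact2 g p == p') = (p'.1 == vact acth g p.1) && (vact acth g p.2 == p'.2).
    by rewrite [p' in LHS]surjective_pairing -pair_eqE /= [p'.1 == _]eq_sym.
  case: eqP => [->|_]; last by rewrite scale0r mul0r.
  case: eqP => [->|_]; rewrite ?scale1r ?scale0r //.
  by rewrite !mulr0.
move: e0; rewrite (bigD1 p') //= [X in _ + X]big1 => [|p /andP[pF np]]; last first.
  rewrite big1 // => g _; rewrite termE //.
  case: eqP => [e|_]; last by rewrite scaler0.
  by case/eqP: np; exact: (transversal_uniq pF p'F (esym e)).
rewrite addr0 (bigID (fun g => vact2 g p' == p')) /= [X in _ + X]big1 => [|g ng].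
  rewrite addr0 (eq_bigr (fun _ => z p')) => [|g gp].
    rewrite sumr_const => /eqP; rewrite -scaler_nat scaler_eq0 => /orP[|/eqP //].
    have -> : #|[pred g | vact2 g p' == p']| =
        #|(vstab_group acth p'.1 :&: vstab_group acth p'.2)%G|.
      by apply: eq_card => g; rewrite !inE vact2_stab !inE.
    by rewrite (negbTE (card_subgroup_neq0 _)).
  rewrite termE // gp; have [_ ->] := ez p' p'F; last by rewrite -vact2_stab.
  by rewrite scalerA mulrC -(pairMr pchi) mulgV pair1r ?scale1r.
by rewrite termE // (negbTE ng) scaler0.
Qed.

(** The compressions [q p] of w (x) h by [eps p.1] and [eps p.2] are eigenvectors for the stabilizer
    of p. Over all pairs of group elements their h-components add up to a nonzero multiple of w;
    grouping this sum along F gives the weights with which the [q p] are lifted. *)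
Lemma total_component_surj w : in_arrow_space i (vact act h j) w ->
  exists2 z, eigen_family z & total_component z = w.
Proof.
move=> [wh wE]; pose W := stens act w h.
pose q (p : V * V) := eps p.1 * W * eps p.2.
have twist_q g p : char_twist chi g (q p) = chi g h *: q (vact2 g p).
  by rewrite !twistM // !twist_eps twist_stens skscaleAr skscaleAl.
(* In the h-component the twist also multiplies by [chi g h], which cancels the factor in
   [twist_q]. *)
have q_inv g p : sk_fun (q (vact2 g p)) h = sk_fun (q p) h.
  have := congr1 (fun z : S => sk_fun z h) (twist_q g p).
  rewrite /= [LHS]sk_fun_twist sk_funZ => e.
  exact: (scalerI (pair_neq0 pchi g h) (esym e)).
pose ci := #|gT|%:R / #|stab i|%:R : k; pose cj := #|gT|%:R / #|stab j|%:R : k.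
(* By [sum_eps_orbit] on both sides the double sum is the multiple [ci * cj] of e_i W e_j, whose
   h-component is w. *)
have sum_q : \sum_(t : gT * gT) sk_fun (q (vact acth t.1 x0, vact acth t.2 y0)) h
    = (ci * cj) *: w.
  rewrite -(pair_big xpredT xpredT
    (fun g g' => sk_fun (q (vact acth g x0, vact acth g' y0)) h)) /=.
  under eq_bigr => g _ do rewrite -sk_fun_sum /q /= -mulr_sumr.
  rewrite -sk_fun_sum -mulr_suml -mulr_suml !sum_eps_orbit -/ci -/cj.
  rewrite !skscaleAl skscaleAr scalerA sk_funZ sk_fun_stens1r sk_fun_stens1l.
  by rewrite sk_fun_stens eqxx qact_vert wE.
have c0 : ci * cj != 0 by rewrite mulf_neq0 ?orbit_coef_neq0.
have /fin_all_exists[r rP] (t : gT * gT) : exists p, p \in F /\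
    sk_fun (q (vact acth t.1 x0, vact acth t.2 y0)) h = sk_fun (q p) h.
  have [p pF [u pE]] := transversal_repr_ex t.1 t.2.
  by exists p; split=> //; rewrite pE q_inv.
(* The weight of p counts the t that [r] sends to p and normalizes by the scalar of [sum_q]. *)
pose c p : k := (ci * cj)^-1 * #|[pred t | r t == p]|%:R.
have /fin_all_exists2[z zA zE] (p : V * V) :
    exists2 u, in_arrow_space p.1 p.2 u & Phi u = c p *: q p.
  apply: ci_fun_lift => [g|]; last first.
    by rewrite skscaleAr skscaleAl /q !mulrA epsM -!mulrA epsM !eqxx !scale1r.
  rewrite sk_funZ; apply: homogeneousZ; rewrite /q sk_funM.
  apply: homogeneous_sum => v _; rewrite -[1%N]addn0.
  apply: homogeneousM; last by apply: homogeneous0_qact; exact: homogeneous_eps.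
  rewrite sk_funM; apply: homogeneous_sum => v' _; rewrite -[1%N]add0n.
  apply: homogeneousM; first exact: homogeneous_eps.
  apply: qact_arrow; rewrite sk_fun_stens; case: ifP => // _.
  exact: homogeneous0.
exists z => [p pF|].
  split=> [|g]; first exact: zA.
  rewrite -vact2_stab => /eqP gp; apply: (@ci_inj _ _ _ _ _ Phi).
  by rewrite hacth ci_funZ zE twistZ twist_q gp scalerA mulrC -scalerA.
rewrite /total_component (eq_bigr (fun p => c p *: sk_fun (q p) h)); last first.
  by move=> p _; rewrite zE; exact: sk_funZ.
apply: (scalerI c0); rewrite -sum_q (partition_big r (mem F)) /=; last first.
  by move=> t _; case: (rP t).
rewrite scaler_sumr; apply: eq_bigr => p _.
rewrite (eq_bigr (fun _ => sk_fun (q p) h)) => [|t /eqP <-]; last by case: (rP t).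
by rewrite [LHS]scalerA mulrA (divff c0) mul1r scaler_nat sumr_const.
Qed.

End ArrowSpace.

(** * The double McKay quiver *)

Section HomSpaces.
Variable Qhh : mckay acth.
Local Notation Vh := (mckay_vert (mk_choice Qhh)).
Implicit Types s : Vh.

Lemma mv_deg_hat1 s : mv_deg s = 1%N.
Proof.
exact: (mx_irr_abelian_linear (splitk (G := _))
  (@irr_irreducible _ _ _ _ (mv_irr s)) (abelian_group _)).
Qed.

Definition dual_point (ht : Vh -> gT) : Prop :=
  forall s, {in vstab acth (mv_vert s), forall g, chi g (ht s) = \tr (mv_rep s g)}.

Lemma dual_point_ex : exists ht, dual_point ht.
Proof.
have /fin_all_exists[ht htP] s : exists h,
    {in vstab acth (mv_vert s), forall g, chi g h = \tr (mv_rep s g)}.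
  apply: (@pair_extends _ _ _ pchi nzG (vstab_group acth (mv_vert s))).
    exact: trace_repr1 (mv_deg_hat1 s).
  exact: trace_reprM (mv_deg_hat1 s).
by exists ht.
Qed.

Variable ht : Vh -> gT.
Hypothesis htP : dual_point ht.

Section Fixed.
Variables s s' : Vh.
Local Notation F := (mc_pairs (mk_choice Qhh) (mv_vert s) (mv_vert s')).
Local Notation hom := (hom_mx s s').
Local Notation h := (ht s * (ht s')^-1)%g.

Lemma deg_gt0 (t : Vh) : (0 < mv_deg t)%N. Proof. by rewrite mv_deg_hat1. Qed.

Definition coord p (X : hom p) (r : 'I_#|arrows_btw p.1 p.2|) : k :=
  X (mxtens_index (Ordinal (deg_gt0 s'), r)) (Ordinal (deg_gt0 s)).

(** Both representations have degree 1, so X amounts to a vector of E_p; this is that vector inside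
    the path algebra. *)
Definition arrow_comb p (X : hom p) : path_alg k Qh :=
  \sum_r coord X r *: earrow k (val (enum_val r)).

Lemma arrow_comb_space p (X : hom p) : in_arrow_space p.1 p.2 (arrow_comb X).
Proof.
apply: in_arrow_space_sum => r _; apply: in_arrow_spaceZ.
exact: in_arrow_space_earrow.
Qed.

Lemma coef_arrow_comb p (X : hom p) r :
  coef (parrow (val (enum_val r))) (arrow_comb X) = coord X r.
Proof.
exact: coef_comb_earrow.
Qed.

Lemma coord_inj p (X Y : hom p) : coord X =1 coord Y -> X = Y.
Proof. by move=> e; apply: (mx_coordP (mv_deg_hat1 s) (mv_deg_hat1 s')) e. Qed.

Lemma coord_sum p I (r : seq I) (l : I -> k) (X : I -> hom p) t :
  coord (\sum_(a <- r) l a *: X a) t = \sum_(a <- r) l a * coord (X a) t.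
Proof. by rewrite /coord summxE; apply: eq_bigr => a _; rewrite mxE. Qed.

Lemma arrow_comb_sum p I (r : seq I) (l : I -> k) (X : I -> hom p) :
  arrow_comb (\sum_(a <- r) l a *: X a) = \sum_(a <- r) l a *: arrow_comb (X a).
Proof.
rewrite /arrow_comb; under [RHS]eq_bigr => a _ do rewrite scaler_sumr.
rewrite exchange_big; apply: eq_bigr => t _ /=.
by rewrite coord_sum scaler_suml; apply: eq_bigr => a _; rewrite scalerA.
Qed.

(** Since p lies in the product of the orbits and the group is abelian, its stabilizers are those of
    the base vertices. There the two representations are the scalars [chi g (ht s)] and
    [chi g (ht s')], and dividing by the second gives the eigenvalue. *)
Lemma is_hom_eigen p (X : hom p) : p \in F ->
  is_hom X <-> {in vstab acth p.1 :&: vstab acth p.2, forall g,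
                  acth g (arrow_comb X) = chi g h *: arrow_comb X}.
Proof.
move=> pF.
have [t [t' pE]] := mem_transversal (mc_pairsP (mk_choice Qhh) _ _) pF.
have coefE g r : coef (parrow (val (enum_val r))) (acth g (arrow_comb X)) =
    \sum_c arrow_mx acth p.1 p.2 g r c * coord X c.
  rewrite /arrow_comb qact_sum coefp_sum; apply: eq_bigr => c _.
  by rewrite qactZ Defs.coefZ mxE mulrC.
have eqvP g : g \in vstab acth p.1 :&: vstab acth p.2 ->
    (mv_rep s' g *t arrow_mx acth p.1 p.2 g) *m X = X *m mv_rep s g <->
    acth g (arrow_comb X) = chi g h *: arrow_comb X.
  rewrite inE => /andP[gp1 gp2].
  have hs : chi g (ht s) = \tr (mv_rep s g).
    by apply: htP; move: gp1; rewrite pE vstab_vact.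
  have hs' : chi g (ht s') = \tr (mv_rep s' g).
    by apply: htP; move: gp2; rewrite pE vstab_vact.
  have nz' : chi g (ht s') * chi g (ht s')^-1%g = 1.
    by rewrite -pairMr // mulgV pair1r.
  rewrite [mv_rep s' g]mx_trace1 ?mv_deg_hat1 //.
  rewrite [mv_rep s g]mx_trace1 ?mv_deg_hat1 //.
  rewrite -hs -hs' (tens_intertwinerP (Ordinal (deg_gt0 s)) (Ordinal (deg_gt0 s'))
    (mv_deg_hat1 s) (mv_deg_hat1 s')).
  split=> [e|e r].
    apply: (arrow_space_eq (i := p.1) (j := p.2)).
    - have := in_arrow_space_qact acth g (arrow_comb_space X).
      by move: gp1 gp2; rewrite !inE => /eqP -> /eqP ->.
    - exact/in_arrow_spaceZ/arrow_comb_space.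
    move=> r; rewrite coefE Defs.coefZ coef_arrow_comb pairMr //.
    by rewrite -[LHS]mul1r -nz' mulrAC (e r) mulrAC.
  have := congr1 (coef (parrow (val (enum_val r)))) e.
  rewrite coefE Defs.coefZ coef_arrow_comb pairMr // => er.
  rewrite -/(coord X r) -[RHS]mul1r -nz'.
  rewrite [LHS](_ : _ =
    chi g (ht s') * (\sum_c arrow_mx acth p.1 p.2 g r c * coord X c)) //.
  by rewrite er; ring.
by split=> e g gp; apply/(eqvP g gp)/e.
Qed.

Definition hat_vert (s : Vh) : vert Q :=
  vact act (ht s)^-1%g (vtx (mv_vert s)).

(** The total component lies in E_(i, hj), and acting by the inverse of [ht s] moves it to the
    arrows between the two [hat_vert]. The resulting [T] carries the basis of the Hom spaces to a
    basis of that arrow space. *)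
Lemma card_hat_arrows :
  #|arrows_btw (Q' := Qhh) s s'| = #|arrows_btw (hat_vert s) (hat_vert s')|.
Proof.
have [b [bhom bspan]] := @mk_basis _ _ _ _ Qhh s s'.
have trF := mc_pairsP (mk_choice Qhh) (mv_vert s) (mv_vert s').
pose T (v : forall p, hom p) : path_alg k Q :=
  act (ht s)^-1%g (total_component h F (fun p => arrow_comb (v p))).
have eigenT (v : forall p, hom p) : (forall p, p \in F -> is_hom (v p)) ->
    eigen_family h F (fun p => arrow_comb (v p)).
  move=> vhom p pF; split; first exact: arrow_comb_space.
  by apply/is_hom_eigen => //; exact: vhom.
have T_space (v : forall p, hom p) : (forall p, p \in F -> is_hom (v p)) ->
    in_arrow_space (hat_vert s) (hat_vert s') (T v).
  move=> /eigenT/(total_component_space trF).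
  move=> /(in_arrow_space_qact act (ht s)^-1%g); rewrite -vactM mulKg.
  exact.
have T_sum (l : _ -> k) (v : forall p, hom p) :
    (forall p, p \in F -> v p = \sum_a l a *: b a p) -> T v = \sum_a l a *: T (b a).
  move=> vE; rewrite /T /total_component.
  under [RHS]eq_bigr => a _ do rewrite -qactZ.
  rewrite -qact_sum; congr (act _ _).
  under [RHS]eq_bigr => a _ do rewrite scaler_sumr.
  rewrite exchange_big; apply: eq_bigr => p pF.
  rewrite (vE p pF) arrow_comb_sum ci_fun_sum sk_fun_sum.
  by apply: eq_bigr => a _; rewrite ci_funZ; exact: sk_funZ.
apply: (card_arrow_space (u := fun a => T (b a))).
- move=> l l0.
  pose v p := \sum_a l a *: b a p.
  have vhom p : p \in F -> is_hom (v p).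
    move=> pF {l0}; apply/is_hom_eigen => // g gp; rewrite /v arrow_comb_sum.
    rewrite qact_sum scaler_sumr; apply: eq_bigr => a _.
    have eg := (is_hom_eigen (b a p) pF).1 (bhom a p pF) g gp.
    by rewrite qactZ {}eg !scalerA mulrC.
  have tc0 : total_component h F (fun p => arrow_comb (v p)) = 0.
    have : act (ht s) (T v) = 0 by rewrite (T_sum l) // l0 qact0.
    by rewrite /T -qactM mulgV qact1.
  have v0 p : p \in F -> v p = 0.
    move=> pF; apply: coord_inj => r.
    have := total_component_inj trF (eigenT v vhom) tc0 pF.
    move/(congr1 (coef (parrow (val (enum_val r))))).
    by rewrite coef_arrow_comb coef_zero => ->; rewrite /coord mxE.
  (* Freeness comes from uniqueness of coordinates: both [l] and 0 are coordinates of [v], which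
     vanishes on F. *)
  have [l1 [_ l1u]] := bspan v vhom.
  have eq1 : l1 = [ffun a => l a].
    by apply: l1u => p pF; apply: eq_bigr => a _; rewrite ffunE.
  have eq2 : l1 = [ffun a => 0].
    by apply: l1u => p pF; rewrite v0 // big1 // => a _; rewrite ffunE scale0r.
  by move=> a; have := congr1 (fun f : {ffun _ -> k} => f a) eq1;
    rewrite eq2 /= !ffunE => <-.
- by move=> a; apply: T_space => p; exact: bhom.
move=> w /(in_arrow_space_qact act (ht s)); rewrite -!vactM !mulgV vact1 => ws.
have [z zeig zE] := total_component_surj trF ws.
(* The entries are the arrow coefficients of [z p], so that [arrow_comb] gives back [z p] on F. *)
pose v p : hom p := \matrix_(q, _)
  coef (parrow (val (enum_val (mxtens_unindex q).2))) (z p).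
have vz p : p \in F -> arrow_comb (v p) = z p.
  move=> pF; have [zp _] := zeig p pF.
  apply: arrow_space_eq (arrow_comb_space _) zp _ => r.
  by rewrite coef_arrow_comb /coord mxE mxtens_indexK.
have vhom p : p \in F -> is_hom (v p).
  by move=> pF; apply/is_hom_eigen => //; rewrite vz //; case: (zeig p pF).
have [l [lE _]] := bspan v vhom.
exists l; rewrite -(T_sum l v) // /T.
rewrite /total_component (eq_bigr (fun p => sk_fun (Phi (z p)) h)) => [|p pF].
  by rewrite -/(total_component h F z) zE -qactM mulVg qact1.
by rewrite vz.
Qed.

End Fixed.

(** * The bijection on vertices *)

Lemma vtx_mc_verts x : vtx x \in mc_verts (mk_choice Qh).
Proof. exact: (valP (x : mckay_vert (mk_choice Qh))). Qed.

Lemma vact_eq_chi i t t' g : vact act t i = vact act t' i ->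
  {in stab i, forall a, chi g a = 1} -> chi g t = chi g t'.
Proof.
move=> tt' gi; have: (t'^-1 * t)%g \in stab i.
  by rewrite inE vactM tt' -vactM mulVg vact1.
by move/gi => e; rewrite -[t](mulKVg t') pairMr // e mulr1.
Qed.

(** Equal images put the two vertices i in one orbit, so they agree, and transitivity over i makes
    the vertices x agree. Then the two [ht] agree modulo G_i, hence pair equally with the stabilizer
    of x, which is orthogonal to G_i, and the two characters coincide. *)
Lemma hat_vert_inj : injective hat_vert.
Proof.
move=> s s' ss'; have i_eq : vtx (mv_vert s) = vtx (mv_vert s').
  apply: mc_verts_uniq; [exact: vtx_mc_verts|exact: vtx_mc_verts|].
  apply/imsetP; exists (ht s' * (ht s)^-1)%g => //.
  by rewrite vactM -/(hat_vert s) ss' -vactM mulgV vact1.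
have x_eq : mv_vert s = mv_vert s'.
  apply: mc_verts_uniq; [exact: (valP s)|exact: (valP s')|].
  have [g gE] := vact_transitive i_eq.
  by apply/imsetP; exists g.
have chi_eq g : g \in vstab acth (mv_vert s) -> chi g (ht s) = chi g (ht s').
  move=> gs; have ga := (mem_vstab_acth _ _).1 gs.
  have tt' : vact act (ht s)^-1%g (vtx (mv_vert s)) =
      vact act (ht s')^-1%g (vtx (mv_vert s)) by rewrite [in RHS]i_eq.
  have e := vact_eq_chi tt' ga; apply: (mulIf (pair_neq0 pchi g (ht s)^-1%g)).
  by rewrite [in RHS]e -!pairMr // !mulgV.
have tr_eq : {in vstab acth (mv_vert s), forall g,
    \tr (mv_rep s g) = \tr (mv_rep s' g)}.
  by move=> g gs; rewrite -!htP -?x_eq // chi_eq.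
have deg_s := mv_deg_hat1 s; have deg_s' := mv_deg_hat1 s'.
(* The types of [r] and [r'] depend on x and x', so these are identified before the irreducibles are
   compared. *)
move: (s) (s') x_eq tr_eq deg_s deg_s' => [[x r] xX] [[x' r'] x'X].
rewrite /mv_vert /mv_rep /mv_irr /mv_deg /= => e.
move: r' x'X; rewrite -{x'}e => r' x'X tr_eq d1 d1'.
have er : r = r' by apply: irr_distinct; exact: mx_rsim_trace.
by apply: val_inj; rewrite /= er.
Qed.

(** Write i0 = t i with i a chosen representative, take a chosen x over i, and let tau be
    [chi _ t^-1] on its stabilizer. By double orthogonality the element [ht s] found for tau agrees
    with t^-1 modulo G_i. *)
Lemma hat_vert_surj (i0 : vert Q) : exists s, hat_vert s = i0.
Proof.
have [_ rX _] := transversal_properties (mc_vertsP (mk_choice Qh)).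
have [i iX] := rX _ (imset_f (vorbit act) (x := i0) isT).
case/imsetP=> t0 _ iE; pose t := (t0^-1)%g.
have vE : i0 = vact act t i by rewrite iE -vactM mulVg vact1.
(* The trivial representation supplies some vertex of the McKay quiver over i; the chosen
   representative of its orbit still lies over i. *)
have [rho irr_rho _] := @linear_repr_irr k gT (stab i) (fun _ => 1)
  (erefl _) (fun _ _ _ _ => esym (mulr1 1)).
have [r _] := irr_complete (mc_irr (mk_choice Qh) i) irr_rho.
pose x0 : mckay_vert (mk_choice Qh) :=
  exist _ (existT (fun i => irr_idx (mc_irr (mk_choice Qh) i)) i r) iX.
have [_ rXh _] := transversal_properties (mc_vertsP (mk_choice Qhh)).
have [x xX] := rXh _ (imset_f (vorbit acth) (x := x0 : V) isT).
case/imsetP=> g0 _ xE; have xi : vtx x = i by rewrite xE vtx_vact.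
have [||rho' irr_rho' trE] := @linear_repr_irr k gT (vstab_group acth x)
  (fun g => chi g t^-1%g).
- exact: pair1l.
- by move=> g h _ _; exact: pairMl.
have [r' rr'] := irr_complete (mc_irr (mk_choice Qhh) x) irr_rho'.
pose s : Vh := exist _ (existT (fun x => irr_idx (mc_irr (mk_choice Qhh) x)) x r') xX.
exists s; rewrite /hat_vert -[mv_vert s]/x xi vE.
have: (t^-1 * (ht s)^-1)%g \in stab i.
  apply: (double_orthogonal pchi nzG) => g gi.
  have gx : g \in vstab acth x by apply/mem_vstab_acth; rewrite xi.
  rewrite pairMr // -trE -(trace_mx_rsim (mv_deg_hat1 s) rr' gx).
  by rewrite -[\tr _](htP (s := s) gx) -pairMr // mulgV pair1r.
rewrite inE => /eqP e; rewrite -{2}e -vactM mulKVg //.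
Qed.

Lemma quiver_iso_hat : quiver_iso Qhh Q.
Proof.
apply: (quiver_iso_card (Q := Qhh) (f := hat_vert)); last exact: card_hat_arrows.
have [f' f'K] := fin_all_exists hat_vert_surj.
by exists f' => // s; apply: hat_vert_inj; rewrite f'K.
Qed.

End HomSpaces.
End Corner.

Theorem proposition3p6
  (k : closedFieldType) (gT : finGroupType) (Q : quiver)
  (act : quiver_action k gT Q)
  (hloop : forall a : arrow Q, src a != tgt a)
  (hfaithful : forall g : gT, (forall x : path_alg k Q, act g x = x) -> g = 1%g)
  (habelian : abelian [set: gT])
  (hchar : forall p : nat, p \in [pchar k] -> ~~ (p %| #|gT|)%N)
  (hadm : admissible act)
  (n : nat) (gen : 'I_n -> gT)
  (hgen : \big[dprod/1%g]_(l < n) <[gen l]>%g = [set: gT])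
  (xi : 'I_n -> k)
  (hxi : forall l : 'I_n, #[gen l]%g.-primitive_root (xi l))
  (chi : gT -> gT -> k)
  (hchi : forall t s : 'I_n -> nat,
     chi (\prod_(l < n) gen l ^+ t l)%g (\prod_(l < n) gen l ^+ s l)%g
     = \prod_(l < n) xi l ^+ (t l * s l)%N)
  (Qh : mckay act)
  (Phi : corner_iso Qh)
  (acth : quiver_action k gT Qh)
  (hacth : forall (g : gT) (x : path_alg k Qh),
     Phi (acth g x) = char_twist chi g (Phi x))
  (Qhh : mckay acth) :
  quiver_iso Qhh Q.
Proof.
have nzG : #|gT|%:R != 0 :> k.
  have gt0 : (0 < #|gT|)%N by rewrite -cardsT cardG_gt0.
  apply/eqP => G0; have [p pk] := natf0_pchar gt0 (introT eqP G0).
  by have := hchar p pk; rewrite (dvdn_pcharf pk) G0 eqxx.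
have pchi := perfect_pairing_of_generators habelian hgen hxi hchi.
have splitk : group_closure_field k gT by exact: group_closure_closed_field.
have [ht htP] := dual_point_ex splitk habelian nzG pchi Qhh.
exact: (quiver_iso_hat splitk habelian nzG pchi hacth htP).
Qed.
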